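(* Let $\Gamma=(V,E)$ be a right angled Coxeter graph and let $C(\Gamma)$ be the corresponding right angled Coxeter group. (i) If $\#V\leq 5$, or if $\#V=6$ and $\#E\leq 8$, then $C(\Gamma)$ is coherent. (ii) If $\Gamma$ is (as a graph) the complete bipartite graph $K_{3,3}$, then $C(\Gamma)$ is incoherent (that is, not coherent).
   Context: A group is coherent if every finitely generated subgroup of it is finitely presented. A right angled Coxeter graph is a finite simplicial (undirected, no loops, no multiple edges) graph $\Gamma=(V,E)$ with $V\neq\emptyset$, all of whose edges carry the label $2$. The right angled Coxeter group $C(\Gamma)$ is given by the presentation $C(\Gamma)=\langle V\mid v^2 \text{ for } v\in V,\ (vw)^2\text{ if }\{v,w\}\in E\rangle$. $K_{3,3}$ is the graph with $6$ vertices divided into two sets of $3$, whose $9$ edges are all pairs consisting of one vertex from each set. *)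

(* Defs.v *)
From HB Require Import structures.
From mathcomp Require Import all_boot.
From mathcomp Require Import boolp.

Set Implicit Arguments.
Unset Strict Implicit.
Unset Printing Implicit Defensive.

Local Open Scope quotient_scope.
Local Open Scope group_scope.

(* Words over the generators [X] and their formal inverses: the letter
   [(x, true)] stands for x, and [(x, false)] for x^-1. *)
Definition word (X : Type) := seq (X * bool).

Definition winv (X : Type) (w : word X) : word X :=
  rev [seq (l.1, ~~ l.2) | l <- w].

(* The congruence on words whose classes are the elements of < X | R >. *)
Inductive pres_eq (X : Type) (R : word X -> Prop) : word X -> word X -> Prop :=
| pres_refl u : pres_eq R u u
| pres_sym u v : pres_eq R u v -> pres_eq R v u
| pres_trans u v w : pres_eq R u v -> pres_eq R v w -> pres_eq R u w
| pres_cat u u' v v' :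
    pres_eq R u u' -> pres_eq R v v' -> pres_eq R (u ++ v) (u' ++ v')
| pres_cancel x b : pres_eq R [:: (x, b); (x, ~~ b)] [::]
| pres_relator r : R r -> pres_eq R r [::].

Section PresentedGroup.
Variables (X : choiceType) (R : word X -> Prop).

(* The word problem is undecidable in general, so this is a boolean relation
   only thanks to classical logic. *)
Definition pres_eqb : rel (word X) := fun u v => `[< pres_eq R u v >].

Lemma pres_eqb_refl : reflexive pres_eqb.
Proof. by move=> u; apply/asboolP/pres_refl. Qed.

Lemma pres_eqb_sym : symmetric pres_eqb.
Proof. by move=> u v; apply/asboolP/asboolP; apply: pres_sym. Qed.

Lemma pres_eqb_trans : transitive pres_eqb.
Proof.
by move=> v u w /asboolP uv /asboolP vw; apply/asboolP/(pres_trans uv vw).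
Qed.

Canonical pres_equiv :=
  EquivRel pres_eqb pres_eqb_refl pres_eqb_sym pres_eqb_trans.

Definition presented_group := {eq_quot pres_equiv}.

HB.instance Definition _ := Choice.on presented_group.
HB.instance Definition _ := EqQuotient.on presented_group.

Definition pres_class (w : word X) : presented_group :=
  \pi_presented_group w.

Definition pres_one := pres_class [::].
Definition pres_mul (x y : presented_group) := pres_class (repr x ++ repr y).
Definition pres_inv (x : presented_group) := pres_class (winv (repr x)).

Lemma pres_classP u v : pres_class u = pres_class v <-> pres_eq R u v.
Proof.
split=> [/eqquotP/asboolP //|uv].
by apply/eqquotP/asboolP.
Qed.

Lemma pres_classK x : pres_class (repr x) = x.
Proof. exact: reprK. Qed.

Lemma pres_repr w : pres_eq R (repr (pres_class w)) w.
Proof. by apply/pres_classP; rewrite pres_classK. Qed.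

Lemma pres_mulE u v :
  pres_mul (pres_class u) (pres_class v) = pres_class (u ++ v).
Proof. by apply/pres_classP/pres_cat; apply: pres_repr. Qed.

Lemma pres_mulVw w : pres_eq R (winv w ++ w) [::].
Proof.
elim: w => [|[x b] w IHw]; first exact: pres_refl.
rewrite /winv /= rev_cons cat_rcons -/(winv w).
apply: pres_trans IHw; apply: pres_cat; first exact: pres_refl.
rewrite -[w in pres_eq _ _ w]cat0s -[_ :: _ :: w]/([:: _; _] ++ w).
apply: pres_cat; last exact: pres_refl.
by rewrite -{2}[b]negbK; exact: pres_cancel.
Qed.

Lemma winvK : involutive (@winv X).
Proof.
move=> w; rewrite /winv map_rev revK -map_comp -[RHS]map_id.
by apply: eq_map => -[x b] /=; rewrite negbK.
Qed.

Lemma pres_mulA : associative pres_mul.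
Proof.
move=> x y z; rewrite -[x]pres_classK -[y]pres_classK -[z]pres_classK.
by rewrite !pres_mulE catA.
Qed.

Lemma pres_mul1 : left_id pres_one pres_mul.
Proof. by move=> x; rewrite -[x]pres_classK pres_mulE. Qed.

Lemma pres_mulr1 : right_id pres_one pres_mul.
Proof. by move=> x; rewrite -[x]pres_classK pres_mulE cats0. Qed.

Lemma pres_mulV : left_inverse pres_one pres_inv pres_mul.
Proof.
move=> x; rewrite -[in X in pres_mul _ X](pres_classK x) pres_mulE.
by apply/pres_classP/pres_mulVw.
Qed.

Lemma pres_mulrV : right_inverse pres_one pres_inv pres_mul.
Proof.
move=> x; rewrite -[in X in pres_mul X _](pres_classK x) pres_mulE.
by apply/pres_classP; rewrite -{1}[repr x]winvK; exact: pres_mulVw.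
Qed.

HB.instance Definition _ := isGroup.Build presented_group
  pres_mulA pres_mul1 pres_mulr1 pres_mulV pres_mulrV.

End PresentedGroup.

(* Subgroups of [G] are the group-closed predicates [S : groupClosed G]; by
   classical logic every subset of [G] is a boolean predicate. *)
Section SubgroupType.
Variables (G : groupType) (S : groupClosed G).

Record subgroup_type := SubgroupElt {
  subgroup_val : G;
  subgroup_valP : subgroup_val \in S
}.

HB.instance Definition _ := [isSub for subgroup_val].
HB.instance Definition _ := [Choice of subgroup_type by <:].

Lemma subgroup_closed : group_closed [in S].
Proof. by split; [exact: gpred1 | exact: gpredF]. Qed.

HB.instance Definition _ :=
  SubChoice_isSubGroup.Build G _ subgroup_type subgroup_closed.

End SubgroupType.

Definition isomorphic (G H : groupType) : Prop :=
  exists f : {multiplicative G -> H}, bijective f.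

Definition finitely_generated (G : groupType) : Prop :=
  exists s : seq G,
    forall S : groupClosed G, {subset s <= S} -> forall x, x \in S.

Definition finitely_presented (G : groupType) : Prop :=
  exists (X : finType) (rels : seq (word X)),
    isomorphic (presented_group (fun r => r \in rels)) G.

Definition coherent (G : groupType) : Prop :=
  forall S : groupClosed G,
    finitely_generated (subgroup_type S) -> finitely_presented (subgroup_type S).

Record racg_graph := RACGGraph {
  vertex : finType;
  edges : {set {set vertex}};
  edges_card2 : forall e, e \in edges -> #|e| = 2;
  vertex_nonempty : 0 < #|vertex|
}.

Definition coxeter_rel (Gam : racg_graph) (r : word (vertex Gam)) : Prop :=
  (exists v, r = [:: (v, true); (v, true)]) \/
  (exists v w, [set v; w] \in edges Gam /\
    r = [:: (v, true); (w, true); (v, true); (w, true)]).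

Definition coxeter_group (Gam : racg_graph) : groupType :=
  presented_group (@coxeter_rel Gam).

Definition is_complete_bipartite (m n : nat) (Gam : racg_graph) : Prop :=
  exists A B : {set vertex Gam},
    [/\ A :|: B = [set: vertex Gam], [disjoint A & B], #|A| = m, #|B| = n &
        edges Gam = [set [set a; b] | a in A, b in B]].

(* Main.v *)
Require Import Defs.
From HB Require Import structures.
From mathcomp Require Import all_boot ssralg ssrnum ssrint zify.
From mathcomp Require Import boolp.

Set Implicit Arguments.
Unset Strict Implicit.
Unset Printing Implicit Defensive.

Local Open Scope group_scope.

(** For the second part, let W be the free product of three groups of order
    two, so that the group of K_{3,3} is W x W, generated by a, b, c in the first
    factor and a', b', c' in the second.  The subgroup P generated by aa', bb',
    c and c' is a fibre product of two copies of W over an infinite dihedral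
    group, and c commutes in P with every conjugate of c' by aa' and bb'.  No
    finite set of relations of P has all these commutations among its
    consequences: let aa' and bb' act on the integers as the reflections x |-> -x
    and x |-> 1 - x, let c exchange 0 and 1 and let c' exchange n and n + 1.  A
    word that is short compared with n, started at any given integer, meets at
    most one of the two exchanges, so it moves that integer in the same way as
    one of its two coordinates in W does ([wact_near], [wact_far]); if the word
    is trivial in P, it therefore acts trivially.  Yet some conjugate of c'
    exchanges 1 and 2, which does not commute with the exchange of 0 and 1.

    For the first part, remove a vertex v from the graph.  The Coxeter group is
    then the amalgamated product of the group H of the remaining graph and of
    K x Z/2, over the group K of the link of v.  If every subgroup of K is
    finitely generated and H is coherent, the amalgam is coherent
    ([amalgam_coherent]).  The condition on K holds as soon as each vertex of the
    link has at most one non-neighbour in it: then K is polycyclic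
    ([special_noetherian]).  A link with at most two vertices has this property.
    If all vertices of a graph with at most five vertices have degree at least
    three, then each has at most one non-neighbour and all links have the
    property.  Finally, a graph with six vertices and at most eight edges has a
    vertex of degree at most two, since 6 * 3 > 2 * 8.  Hence vertices can be
    removed one by one.

    The amalgam acts on its Bass-Serre tree, whose vertices are the cosets gH,
    with gH adjacent to gvH.  Let S be a finitely generated subgroup.  The paths
    in the tree spelled by the generators meet finitely many S-orbits of edges
    ([finite_core]), so S is assembled from a finite graph of groups, where an
    edge of the tree inverted by S becomes its own reverse.  The edge groups are conjugate into K, hence finitely generated.  In each
    vertex group choose a finitely generated subgroup that contains the adjacent
    edge groups, in such a way that together with the elements attached to the
    edges they generate S; these subgroups are finitely presented because H is
    coherent.  Their relators and finitely many relators for the edges present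
    S: a word with trivial value in S can be read as a closed path, a closed path
    of positive length in a tree backtracks somewhere, the edge relators remove
    the backtracking ([path_reduce]), and in the end a word of a single vertex
    group is left ([finitely_related_val]). *)

(** * Evaluation of words *)

Section Evaluation.
Variables (X : Type) (T : groupType) (f : X -> T).

Definition leval (l : X * bool) : T := if l.2 then f l.1 else (f l.1)^-1.

Definition weval (w : word X) : T := foldr (fun l y => leval l * y) 1 w.

Lemma weval_cat u w : weval (u ++ w) = weval u * weval w.
Proof. by elim: u => [|l u IH] /=; rewrite ?mul1g // IH mulgA. Qed.

Lemma weval_inv w : weval (winv w) = (weval w)^-1.
Proof.
elim: w => [|[x b] w IH]; first by rewrite invg1.
rewrite /winv /= rev_cons -cats1 weval_cat -/(winv w) IH invgM /= mulg1.
by case: b; rewrite /leval //= invgK.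
Qed.

(** Von Dyck: an evaluation that kills the relators factors through the
    presented group. *)
Lemma weval_pres_eq (R : word X -> Prop) :
  (forall r, R r -> weval r = 1) ->
  forall u w, pres_eq R u w -> weval u = weval w.
Proof.
move=> R1 u w; elim=> {u w} //.
- by move=> u w x _ -> _ ->.
- by move=> u u' w w' _ IHu _ IHw; rewrite !weval_cat IHu IHw.
- by move=> x [] /=; rewrite mulg1 /leval /= ?mulgV ?mulVg.
Qed.

End Evaluation.

Lemma eq_weval (X : Type) (T : groupType) (f g : X -> T) :
  f =1 g -> weval f =1 weval g.
Proof. by move=> fg; elim=> //= -[x b] w ->; rewrite /leval /= fg. Qed.

Lemma morph_group1 (T U : groupType) (h : T -> U) :
  (forall x y, h (x * y) = h x * h y) -> h 1 = 1.
Proof. by move=> hM; apply: (mulgI (h 1)); rewrite -hM !mulg1. Qed.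

Lemma weval_morph (X : Type) (T U : groupType) (h : T -> U) (f : X -> T) :
  (forall x y, h (x * y) = h x * h y) ->
  forall w, h (weval f w) = weval (h \o f) w.
Proof.
move=> hM.
have h1 := morph_group1 hM.
have hV x : h x^-1 = (h x)^-1.
  by apply: (mulgI (h x)); rewrite -hM !mulgV.
by elim=> //= -[x b] w IH; rewrite hM IH /leval /=; case: b; rewrite ?hV.
Qed.

Definition wmap (X Y : Type) (h : X -> Y) (w : word X) : word Y :=
  [seq (h l.1, l.2) | l <- w].

Lemma weval_wmap (X Y : Type) (T : groupType) (h : X -> Y) (f : Y -> T) w :
  weval f (wmap h w) = weval (f \o h) w.
Proof. by elim: w => //= l w ->. Qed.

Definition wsubst (X Y : Type) (psi : X -> word Y) (w : word X) : word Y :=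
  flatten [seq if l.2 then psi l.1 else winv (psi l.1) | l <- w].

Section Substitution.
Variables (X Y : Type) (psi : X -> word Y).

Lemma wsubst_cat u w : wsubst psi (u ++ w) = wsubst psi u ++ wsubst psi w.
Proof. by rewrite /wsubst map_cat flatten_cat. Qed.

Lemma weval_wsubst (T : groupType) (f : Y -> T) w :
  weval f (wsubst psi w) = weval (fun x => weval f (psi x)) w.
Proof.
elim: w => // -[x b] w IH.
rewrite -cat1s wsubst_cat weval_cat IH /wsubst.
by rewrite /= cats0; case: b; rewrite /leval //= weval_inv.
Qed.

End Substitution.

(** * Presented groups *)

Section PresentedGroups.
Variables (X : choiceType) (R : word X -> Prop).

Definition pres_gen (x : X) : presented_group R := pres_class R [:: (x, true)].

Lemma pres_classM u w :
  pres_class R (u ++ w) = pres_class R u * pres_class R w.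
Proof. by rewrite -(pres_mulE R u w). Qed.

Lemma pres_class_weval w : pres_class R w = weval pres_gen w.
Proof.
elim: w => // -[x b] w IH; rewrite -cat1s pres_classM IH; congr (_ * _).
case: b => //; apply: (mulgI (pres_gen x)); rewrite mulgV.
by rewrite -pres_classM; apply/pres_classP/(pres_cancel _ x true).
Qed.

Lemma pres_class1 w : weval pres_gen w = 1 <-> pres_eq R w [::].
Proof.
by rewrite -pres_class_weval; split=> [h|/(pres_classP R w [::]) ->//]; apply/pres_classP.
Qed.

Variables (T : groupType) (f : X -> T).
Hypothesis f_rel : forall r, R r -> weval f r = 1.

Definition pres_lift (u : presented_group R) : T := weval f (repr u).

Lemma pres_lift_weval w : pres_lift (weval pres_gen w) = weval f w.
Proof.
rewrite -pres_class_weval; apply: weval_pres_eq f_rel _ _ _.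
exact: pres_repr.
Qed.

Lemma pres_weval_repr (u : presented_group R) : u = weval pres_gen (repr u).
Proof. by rewrite -pres_class_weval pres_classK. Qed.

Lemma pres_liftM u w : pres_lift (u * w) = pres_lift u * pres_lift w.
Proof.
by rewrite [u]pres_weval_repr [w]pres_weval_repr -weval_cat !pres_lift_weval weval_cat.
Qed.

End PresentedGroups.

Lemma pres_eq_wsubst (X Y : choiceType) (psi : X -> word Y)
    (R : word X -> Prop) (R' : word Y -> Prop) :
    (forall r, R r -> pres_eq R' (wsubst psi r) [::]) ->
  forall u w, pres_eq R u w -> pres_eq R' (wsubst psi u) (wsubst psi w).
Proof.
move=> RR' u w uw; apply/pres_classP.
rewrite !pres_class_weval !weval_wsubst; apply: weval_pres_eq uw => r /RR'.
by rewrite -weval_wsubst => /pres_class1.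
Qed.

(** * Subgroups *)

Definition is_subgroup (G : groupType) (P : G -> Prop) :=
  [/\ P 1, forall x y, P x -> P y -> P (x * y) & forall x, P x -> P x^-1].

Inductive generated (G : groupType) (A : G -> Prop) : G -> Prop :=
| generated_in x : A x -> generated A x
| generated1 : generated A 1
| generatedM x y : generated A x -> generated A y -> generated A (x * y)
| generatedV x : generated A x -> generated A x^-1.

Section Generated.
Variables (G : groupType).
Implicit Types (A B : G -> Prop).

Lemma generated_subgroup A : is_subgroup (generated A).
Proof. by split; [apply: generated1|apply: generatedM|apply: generatedV]. Qed.

Lemma generated_sub A B :
  is_subgroup B -> (forall x, A x -> B x) -> forall x, generated A x -> B x.
Proof. by move=> [B1 BM BV] AB x; elim=> {x}; auto. Qed.

Lemma generated_mono A B :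
  (forall x, A x -> B x) -> forall x, generated A x -> generated B x.
Proof.
move=> AB; apply: generated_sub; first exact: generated_subgroup.
by move=> x /AB; apply: generated_in.
Qed.

(** The normal form used to walk along an element one letter at a time. *)
Lemma generated_weval A x :
  generated A x <-> exists2 w : word G, (forall l, l \in w -> A l.1) & weval id w = x.
Proof.
split.
  elim=> {x}.
  - move=> x Ax; exists [:: (x, true)]; last by rewrite /= mulg1.
    by move=> l /[1!inE] /eqP ->.
  - by exists [::].
  - move=> x y _ [u Au <-] _ [w Aw <-]; exists (u ++ w); last exact: weval_cat.
    by move=> l; rewrite mem_cat => /orP [/Au|/Aw].
  - move=> x _ [u Au <-]; exists (winv u); last exact: weval_inv.
    by move=> l; rewrite mem_rev => /mapP [m /Au Am ->].
case=> w Aw <-; elim: w Aw => [|[y b] w IH] Aw; first exact: generated1.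
apply: generatedM; last by apply: IH => l lw; apply: Aw; rewrite inE lw orbT.
have Ay : A y by apply: (Aw (y, b)); rewrite inE eqxx.
by case: b {Aw}; rewrite /leval /=; [|apply: generatedV]; apply: generated_in.
Qed.

Lemma is_subgroup_meet A B :
  is_subgroup A -> is_subgroup B -> is_subgroup (fun x => A x /\ B x).
Proof.
move=> [A1 AM AV] [B1 BM BV]; split=> //.
- by move=> x y [? ?] [? ?]; auto.
- by move=> x [? ?]; auto.
Qed.

Lemma is_subgroup_conj (g : G) A :
  is_subgroup A -> is_subgroup (fun x => A (g^-1 * x * g)).
Proof.
move=> [A1 AM AV]; split.
- by rewrite ?gnorm.
- by move=> x y Ax Ay; have := AM _ _ Ax Ay; rewrite ?gnorm.
- by move=> x /AV; rewrite ?gnorm.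
Qed.

End Generated.

Lemma range_generated (G : groupType) (X : Type) (f : X -> G) x :
  generated (fun y => exists i, y = f i) x <-> exists w, x = weval f w.
Proof.
split.
  elim=> {x}.
  - by move=> _ [i ->]; exists [:: (i, true)]; rewrite /= mulg1.
  - by exists [::].
  - by move=> _ _ _ [u ->] _ [w ->]; exists (u ++ w); rewrite weval_cat.
  - by move=> _ _ [u ->]; exists (winv u); rewrite weval_inv.
case=> w ->; elim: w => [|[i b] w IH] /=; first exact: generated1.
apply: generatedM => //; case: b; rewrite /leval /=; [|apply: generatedV];
by apply: generated_in; exists i.
Qed.

(** * Finite presentability relative to a generating family *)

(** The group generated by the family has a finite presentation with this very
    family as generators.  The letters are indices rather than elements of [G],
    so that repeated generators do no harm. *)
Definition finitely_related (X : finType) (G : groupType) (f : X -> G) :=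
  exists2 R : seq (word X), (forall r, r \in R -> weval f r = 1) &
    forall w, weval f w = 1 -> pres_eq (fun r => r \in R) w [::].

(** Tietze: rewrite the old relators in the new generators, and add for every
    new generator the relator saying that translating it to the old generators
    and back does not change it. *)
Lemma finitely_related_indep (X Y : finType) (G : groupType) (f : X -> G) (g : Y -> G) :
    (forall x, exists w, f x = weval g w) ->
    (forall y, exists w, g y = weval f w) ->
  finitely_related f -> finitely_related g.
Proof.
move=> /choice [psi fE] /choice [phi gE] [R R1 Rcomplete].
pose R' := [seq wsubst psi r | r <- R] ++
  [seq (y, false) :: wsubst psi (phi y) | y <- enum Y].
have psiE w : weval g (wsubst psi w) = weval f w.
  by rewrite weval_wsubst; apply: eq_weval => x; rewrite fE.
exists R' => [r|w w1].
  rewrite mem_cat => /orP [/mapP [s sR ->]|/mapP [y _ ->]].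
    by rewrite psiE R1.
  by rewrite /= psiE -gE /leval /= mulVg.
have eqw : pres_eq (fun r => r \in R') w (wsubst psi (wsubst phi w)).
  apply/pres_classP; rewrite !pres_class_weval !weval_wsubst.
  apply: eq_weval => y; rewrite -weval_wsubst.
  apply/esym/(mulgI (pres_gen _ y)^-1); rewrite mulVg.
  have : pres_eq (fun r => r \in R') ((y, false) :: wsubst psi (phi y)) [::].
    by apply: pres_relator; rewrite mem_cat orbC (map_f (fun y => _ :: _)) ?mem_enum.
  by move/pres_class1.
apply: pres_trans eqw _.
rewrite -[[::]]/(wsubst psi [::]); apply: pres_eq_wsubst (Rcomplete _ _).
  by move=> r rR; apply: pres_relator; rewrite mem_cat map_f.
by rewrite -w1 weval_wsubst; apply: eq_weval => y; rewrite gE.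
Qed.

(** Conjugation is injective, so the same relators serve both families. *)
Lemma finitely_related_conj (X : finType) (G : groupType) (f : X -> G) (g : G) :
  finitely_related (fun x => g^-1 * f x * g) -> finitely_related f.
Proof.
have wE w : weval (fun x => g^-1 * f x * g) w = g^-1 * weval f w * g.
  rewrite (weval_morph (h := fun x => g^-1 * x * g)) //.
  by move=> x y; rewrite ?gnorm.
case=> R R1 RC; exists R => [r /R1|w w1].
  by rewrite wE => /(congr1 (fun x => g * x * g^-1)); rewrite ?gnorm.
by apply: RC; rewrite wE w1; rewrite ?gnorm.
Qed.

(** * Subgroups as types *)

Section ClosedOfSubgroup.
Variables (G : groupType) (P : G -> Prop) (Psub : is_subgroup P).

(** The proof that [P] is a subgroup is an argument so that the structure of
    closed predicate can be inferred from the term. *)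
Definition closed_of of is_subgroup P : {pred G} := [pred x | `[< P x >]].

Fact closed_of_mul : mulg_closed (closed_of Psub).
Proof. by have [_ PM _] := Psub => x y /asboolP Px /asboolP Py; apply/asboolP/PM. Qed.

Fact closed_of_one : 1 \in closed_of Psub.
Proof. by have [P1 _ _] := Psub; apply/asboolP. Qed.

Fact closed_of_inv : invg_closed (closed_of Psub).
Proof. by have [_ _ PV] := Psub => x /asboolP Px; apply/asboolP/PV. Qed.

HB.instance Definition _ := isMulClosed.Build G (closed_of Psub) closed_of_mul.
HB.instance Definition _ := isMul1Closed.Build G (closed_of Psub) closed_of_one.
HB.instance Definition _ := isInvClosed.Build G (closed_of Psub) closed_of_inv.

End ClosedOfSubgroup.

Lemma in_closed_of (G : groupType) (P : G -> Prop) (Psub : is_subgroup P) x :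
  x \in closed_of Psub <-> P x.
Proof. by split=> /asboolP. Qed.

Lemma closed_subgroup (G : groupType) (S : groupClosed G) :
   is_subgroup (fun x => x \in S).
Proof.
split; [exact: gpred1 | by move=> x y; apply: gpredM | by move=> x; rewrite gpredV].
Qed.

Section FormalSubgroups.
Variables (G : groupType) (S : groupClosed G).

Lemma weval_subgroup_val (X : Type) (f : X -> subgroup_type S) w :
  val (weval f w) = weval (val \o f) w.
Proof. by apply: weval_morph => x y; rewrite valM. Qed.

Lemma finitely_generated_family :
  finitely_generated (subgroup_type S) ->
  exists (X : finType) (f : X -> G), forall x, x \in S <-> exists w, x = weval f w.
Proof.
case=> s gen_s; pose f i := tnth (in_tuple s) i.
exists ('I_(size s)), (val \o f) => x; split=> [xS|[w ->]]; last first.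
  by rewrite -weval_subgroup_val; apply: valP.
have [w fw] : exists w, SubgroupElt xS = weval f w.
  apply/range_generated/(in_closed_of (generated_subgroup _)).
  apply: gen_s => y /(tnthP (in_tuple s)) [i ->].
  by apply/in_closed_of/generated_in; exists i.
by exists w; rewrite -weval_subgroup_val -fw.
Qed.

Lemma family_finitely_generated (X : finType) (f : X -> G) :
  (forall x, x \in S <-> exists w, x = weval f w) ->
  finitely_generated (subgroup_type S).
Proof.
move=> Sf; have fS i : f i \in S.
  by apply/Sf; exists [:: (i, true)]; rewrite /= mulg1.
pose g i := SubgroupElt (fS i).
exists [seq g i | i <- enum X] => T gT x.
have /Sf [w xE] := valP x.
have -> : x = weval g w by apply/val_inj; rewrite weval_subgroup_val.
have : generated (fun y => exists i, y = g i) (weval g w).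
  by apply/range_generated; exists w.
apply: (generated_sub (B := fun x => x \in T)); first exact: closed_subgroup.
by move=> _ [i ->]; apply/gT/map_f; rewrite mem_enum.
Qed.

End FormalSubgroups.

Lemma finitely_presented_related (G : groupType) (S : groupClosed G) :
    finitely_presented (subgroup_type S) ->
  exists (X : finType) (f : X -> G),
    (forall x, x \in S <-> exists w, x = weval f w) /\ finitely_related f.
Proof.
case=> X [R [h /[dup] /bij_inj h_inj [h' _ hK]]].
have h1 : h 1 = 1 by apply: morph_group1; apply: gmulfM.
pose f x : G := val (h (pres_gen _ x)).
have fE w : weval f w = val (h (weval (pres_gen _) w)).
  rewrite (weval_morph (h := h)); last exact: gmulfM.
  by rewrite weval_subgroup_val.
exists X, f; split=> [x|].
  split=> [xS|[w ->]]; last by rewrite fE; apply: valP.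
  exists (repr (h' (SubgroupElt xS))).
  by rewrite fE -pres_weval_repr hK.
exists R => [r rR|w].
  have r1 : weval (pres_gen (fun r => r \in R)) r = 1.
    exact/pres_class1/pres_relator.
  by rewrite fE r1 h1.
rewrite fE => w1; apply/pres_class1/h_inj/val_inj.
by rewrite w1 h1.
Qed.

Lemma finitely_related_presented (G : groupType) (S : groupClosed G)
    (X : finType) (f : X -> G) :
    (forall x, x \in S <-> exists w, x = weval f w) -> finitely_related f ->
  finitely_presented (subgroup_type S).
Proof.
move=> Sf [R R1 RC]; have fS i : f i \in S.
  by apply/Sf; exists [:: (i, true)]; rewrite /= mulg1.
pose g i := SubgroupElt (fS i).
have gE w : val (weval g w) = weval f w by rewrite weval_subgroup_val.
have gR r : r \in R -> weval g r = 1 by move/R1 => r1; apply/val_inj; rewrite gE.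
pose h := pres_lift (R := fun r => r \in R) g.
pose hm : {multiplicative _ -> _} :=
  HB.pack h (isMultiplicative.Build _ _ h (pres_liftM gR)).
exists X, R, hm.
pose h' (x : subgroup_type S) := weval (pres_gen (fun r => r \in R))
  (sval (cid ((Sf _).1 (valP x)))).
have hh' : cancel h' h.
  move=> x; rewrite /h' /h pres_lift_weval //; case: cid => w /= xE.
  by apply/val_inj; rewrite gE.
exists h' => // u; rewrite /h'; case: cid => w /=.
rewrite /h [u in pres_lift _ u]pres_weval_repr pres_lift_weval // gE => uw.
rewrite [u in RHS]pres_weval_repr; apply/esym/divg1_eq.
rewrite -weval_inv -weval_cat; apply/pres_class1/RC.
by rewrite weval_cat weval_inv uw mulgV.
Qed.

(** * Actions of Coxeter groups *)

Section LetterActions.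
Variables (X Y : Type) (m : X -> Y -> Y).

(** The exponents of the letters are ignored: letters will act as involutions. *)
Definition wact (w : word X) (y : Y) : Y := foldr (fun l => m l.1) y w.

Lemma wact_cat u w y : wact (u ++ w) y = wact u (wact w y).
Proof. exact: foldr_cat. Qed.

Lemma wact_pres_eq (R : word X -> Prop) :
  (forall x, involutive (m x)) -> (forall r, R r -> wact r =1 id) ->
  forall u w, pres_eq R u w -> wact u =1 wact w.
Proof.
move=> mK mR u w; elim=> {u w} //.
- by move=> u w _ uw y; rewrite uw.
- by move=> u v w _ uv _ vw y; rewrite uv.
- by move=> u u' v v' _ uu' _ vv' y; rewrite !wact_cat uu' vv'.
- by move=> x b y; apply: mK.
Qed.

Lemma act_weval (T : groupType) (act : T -> Y -> Y) (f : X -> T) :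
    act 1 =1 id -> (forall g h y, act (g * h) y = act g (act h y)) ->
    (forall x, involutive (m x)) -> (forall x, act (f x) =1 m x) ->
  forall w, act (weval f w) =1 wact w.
Proof.
move=> act1 actM mK actf; elim=> [|[x b] w IH] y //=.
rewrite actM IH /leval; case: b => /=; first exact: actf.
by apply: (inv_inj (mK x)); rewrite mK -actf -actM mulgV act1.
Qed.

End LetterActions.

Section CoxeterGroups.
Variable Gam : racg_graph.
Let V := vertex Gam.
Notation G := (coxeter_group Gam).

Definition cgen (v : V) : G := pres_gen (@coxeter_rel Gam) v.

Lemma cgen2 v : cgen v * cgen v = 1.
Proof.
have /pres_relator/pres_class1 : coxeter_rel [:: (v, true); (v, true)].
  by left; exists v.
by rewrite /= mulg1.
Qed.

Lemma cgenV v : (cgen v)^-1 = cgen v.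
Proof. by apply: (mulgI (cgen v)); rewrite mulgV cgen2. Qed.

Lemma cgen_commute v w :
  [set v; w] \in edges Gam -> commute (cgen v) (cgen w).
Proof.
move=> vw; have : coxeter_rel [:: (v, true); (w, true); (v, true); (w, true)].
  by right; exists v, w.
move/pres_relator/pres_class1 => /=.
rewrite /leval /= -!/(cgen _) mulg1 mulgA => /mulg1_eq.
by rewrite invgM !cgenV => /esym.
Qed.

Lemma cgen_weval (x : G) : exists w, x = weval cgen w.
Proof. by exists (repr x); apply: pres_weval_repr. Qed.

(** The defining relations only ask for involutions that commute along edges. *)
Lemma coxeter_action (Y : Type) (m : V -> Y -> Y) :
    (forall v, involutive (m v)) ->
    (forall v w, [set v; w] \in edges Gam ->
       forall y, m v (m w y) = m w (m v y)) ->
  exists act : G -> Y -> Y,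
    [/\ act 1 =1 id, forall g h y, act (g * h) y = act g (act h y)
      & forall v, act (cgen v) =1 m v].
Proof.
move=> mK mC; pose act (g : G) := wact m (repr g).
have mR r : coxeter_rel r -> wact m r =1 id.
  case=> [[v ->]|[v [w [vw ->]]]] y /=; first exact: mK.
  by rewrite (mC w v) 1?setUC // !mK.
have actE w : act (weval cgen w) =1 wact m w.
  apply: (wact_pres_eq mK mR); apply/pres_classP.
  by rewrite pres_classK pres_class_weval.
exists act; split=> [y|g h y|v y].
- by rewrite -[1]/(weval cgen [::]) actE.
- have [u ->] := cgen_weval g; have [w ->] := cgen_weval h.
  by rewrite -weval_cat !actE wact_cat.
- by rewrite -[cgen v](mulg1 _) -[_ * 1]/(weval cgen [:: (v, true)]) actE.
Qed.

End CoxeterGroups.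

(** * Incoherence of the group of K_{3,3} *)

Section IntegerAction.
Import GRing.Theory Num.Theory.
Local Open Scope ring_scope.

Definition swap (k x : int) : int :=
  if x == k then k + 1 else if x == k + 1 then k else x.

Lemma swap_cases k x :
  x = k /\ swap k x = k + 1 \/ x = k + 1 /\ swap k x = k \/
  x <> k /\ x <> k + 1 /\ swap k x = x.
Proof. by rewrite /swap; case: eqP => [|?]; [|case: eqP]; lia. Qed.

Lemma swapK k : involutive (swap k).
Proof. by move=> x; have := swap_cases k x; have := swap_cases k (swap k x); lia. Qed.

(** The letters (false, false), (false, true), (true, false) and (true, true)
    stand for aa', bb', c and c'; the flags [near] and [far] say whether c and c'
    act.  Switching c' off yields the action of the first coordinate of P, and
    switching c off that of the second. *)
Definition letter_move (near far : bool) (n : nat) (l : bool * bool) (x : int) : int :=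
  match l with
  | (false, false) => - x
  | (false, true) => 1 - x
  | (true, false) => if near then swap 0 x else x
  | (true, true) => if far then swap n x else x
  end.

Lemma letter_moveK near far n l : involutive (letter_move near far n l).
Proof.
by move=> x; case: l => [[] []] /=; [case: far|case: near| |];
   rewrite ?swapK //; lia.
Qed.

(** Each letter of the first coordinate increases the absolute value by at most
    one, so a short word started close to 0 never reaches [n]. *)
Lemma wact_near n w x : (`|x| + size w < n)%N ->
  wact (letter_move true true n) w x = wact (letter_move true false n) w x
  /\ (`|wact (letter_move true false n) w x| <= `|x| + size w)%N.
Proof.
elim: w => [|[l b] w IH] /= xn; first by split; lia.
have [|-> le_y] := IH; first lia.
move: (wact _ w x) le_y => y le_y.
have := swap_cases 0 y; have := swap_cases n y.
by case: l => [[] []] /=; lia.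
Qed.

(** Symmetrically, a word started far from 0 never comes back to 0 or 1. *)
Lemma wact_far n w x : (size w + 1 < `|x|)%N ->
  wact (letter_move true true n) w x = wact (letter_move false true n) w x
  /\ (`|x| <= `|wact (letter_move false true n) w x| + size w)%N.
Proof.
elim: w => [|[l b] w IH] /= xn; first by split; lia.
have [|-> le_y] := IH; first lia.
move: (wact _ w x) le_y => y le_y.
have := swap_cases 0 y; have := swap_cases n y.
by case: l => [[] []] /=; lia.
Qed.

(** The product of the two reflections is a translation by one, so the exchange
    of [n] and [n + 1] is moved [k] steps towards 0. *)
Fixpoint conj_word (k : nat) : word (bool * bool) :=
  if k is k'.+1 then
    [:: ((false, false), true); ((false, true), true)] ++ conj_word k' ++
    [:: ((false, true), true); ((false, false), true)]
  else [:: ((true, true), true)].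

Lemma wact_conj_word n k x :
  wact (letter_move true true n) (conj_word k) x = swap (n%:Z - k%:Z) x.
Proof.
elim: k x => [|k IH] x; first by rewrite subr0.
rewrite /= wact_cat IH /=.
have := swap_cases (n%:Z - k.+1%:Z) x.
by have := swap_cases (n%:Z - k%:Z) (1 - - x); lia.
Qed.

End IntegerAction.

(** One factor of the group of K_{3,3} acts on the integers, the other acts
    trivially. *)
Definition triple_move (V : eqType) (a b c : V) (s : int -> int) (v : V)
    (x : int) : int :=
  if v == a then (- x)%R else if v == b then (1 - x)%R
  else if v == c then s x else x.

(** Two adjacent vertices cannot both move something, so nothing has to be
    checked for the relation of an edge. *)
Lemma triple_action (Gam : racg_graph) (a b c : vertex Gam) (s : int -> int) :
    involutive s ->
    (forall v w, v \in [:: a; b; c] -> w \in [:: a; b; c] ->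
       [set v; w] \notin edges Gam) ->
  exists act : coxeter_group Gam -> int -> int,
    [/\ act 1 =1 id, forall g h y, act (g * h) y = act g (act h y)
      & forall v, act (cgen v) =1 triple_move a b c s v].
Proof.
move=> sK indep.
have mid v : v \notin [:: a; b; c] -> triple_move a b c s v =1 id.
  by rewrite !inE !negb_or => /and3P [/negPf va /negPf vb /negPf vc] x;
     rewrite /triple_move va vb vc.
apply: coxeter_action => [v x|v w vw x].
  by rewrite /triple_move; case: eqP => _; [|case: eqP => _; [|case: eqP => _]];
     rewrite ?sK //; lia.
have [vin|vout] := boolP (v \in [:: a; b; c]); last by rewrite !(mid v vout).
have [win|wout] := boolP (w \in [:: a; b; c]); last by rewrite !(mid w wout).
by case/negP: (indep v w vin win).
Qed.

Section Incoherence.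
Variables (Gam : racg_graph) (A B : {set vertex Gam}).
Hypotheses (AB0 : [disjoint A & B]) (cardA : #|A| = 3) (cardB : #|B| = 3).
Hypothesis edgesE : edges Gam = [set [set a; b] | a in A, b in B].
Notation G := (coxeter_group Gam).

Lemma cross_edge a b : a \in A -> b \in B -> [set a; b] \in edges Gam.
Proof. by move=> aA bB; rewrite edgesE; apply/imset2P; exists a b. Qed.

Lemma edge_cross v w : [set v; w] \in edges Gam ->
  v \in A /\ w \in B \/ v \in B /\ w \in A.
Proof.
rewrite edgesE => /imset2P [a b aA bB vwE].
have /set2P va : v \in [set a; b] by rewrite -vwE set21.
have /set2P wa : w \in [set a; b] by rewrite -vwE set22.
have /set2P av : a \in [set v; w] by rewrite vwE set21.
have /set2P bv : b \in [set v; w] by rewrite vwE set22.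
case: va wa av bv => -> [] ->; try by auto.
  by move=> _ [] ba; rewrite ba (disjointFr AB0 aA) in bB.
by case=> ab; rewrite -ab (disjointFr AB0 aA) in bB.
Qed.


Lemma uniq_triple (V : eqType) (a b c : V) : uniq [:: a; b; c] ->
  [/\ (b == a) = false, (c == a) = false & (c == b) = false].
Proof.
rewrite /= !inE andbT negb_or (eq_sym b a) (eq_sym c a) (eq_sym c b).
by case/andP=> /andP [/negPf -> /negPf ->] /negPf ->.
Qed.

(** Conjugating [z] by an element of the second factor is not affected by a
    component of the conjugating element in the first. *)
Lemma sandwich (T : groupType) (x y z : T) :
  commute x y -> commute x z -> x * x = 1 -> x * y * z * (x * y) = y * z * y.
Proof.
move=> xy xz x2.
by rewrite {1}xy -(mulgA y x z) xz !mulgA -(mulgA _ x x) x2 mulg1.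
Qed.

Lemma mulg_mid (T : groupType) (x : T) : x * x = 1 -> forall y, y * x * x = y.
Proof. by move=> x2 y; rewrite -mulgA x2 mulg1. Qed.

(** A finite set of relators of P would contain words of length at most [L] only,
    and such words act trivially on the integers for [n] large compared with
    [L]; then every relation of P would hold in that action, in particular the
    one saying that c commutes with the conjugate of c' that exchanges 1 and 2. *)
Lemma K33_incoherent : ~ coherent G.
Proof.
move=> coh.
have [a [b [c [abcU abcA]]]] : exists a b c, uniq [:: a; b; c] /\
    {subset [:: a; b; c] <= A}.
  move: cardA (enum_uniq A) (mem_enum A); rewrite cardE.
  case: (enum A) => [|a [|b [|c []]]] //= _ U sA.
  by exists a, b, c; split=> // v; rewrite sA.
have [a' [b' [c' [abcU' abcB]]]] : exists a b c, uniq [:: a; b; c] /\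
    {subset [:: a; b; c] <= B}.
  move: cardB (enum_uniq B) (mem_enum B); rewrite cardE.
  case: (enum B) => [|a' [|b' [|c' []]]] //= _ U sB.
  by exists a', b', c'; split=> // v; rewrite sB.
have comm v w : v \in A -> w \in B -> commute (cgen v) (cgen w).
  by move=> vA wB; apply/cgen_commute/cross_edge.
have [[aA bA cA] [aB bB cB]] :
    [/\ a \in A, b \in A & c \in A] /\ [/\ a' \in B, b' \in B & c' \in B].
  by split; split; (apply: abcA || apply: abcB); rewrite !inE eqxx ?orbT.
have [ba ca cb] := uniq_triple abcU; have [ba' ca' cb'] := uniq_triple abcU'.
pose f (l : bool * bool) : G := match l with
  | (false, false) => cgen a * cgen a'
  | (false, true) => cgen b * cgen b'
  | (true, false) => cgen c
  | (true, true) => cgen c'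
  end.
pose S := closed_of (generated_subgroup (fun y => exists l, y = f l)).
have SE x : x \in S <-> exists w, x = weval f w.
  by rewrite -range_generated; apply: in_closed_of.
have /finitely_presented_related [X [g [Sg relg]]] := coh S (family_finitely_generated SE).
have {relg} [R R1 RC] : finitely_related f.
  apply: finitely_related_indep relg => [x|l].
    by apply/SE/Sg; exists [:: (x, true)]; rewrite /= mulg1.
  by apply/Sg/SE; exists [:: (l, true)]; rewrite /= mulg1.
have [L RL] : exists L, forall r, r \in R -> size r <= L.
  by exists (\max_(r <- R) size r) => r rR; apply: leq_bigmax_seq.
(* For words of length at most [L], every integer is then either close enough to
   0 or far enough from it. *)
have [n nE] : exists n, n = L.*2 + 3 by exists (L.*2 + 3).
have kill r : r \in R -> wact (letter_move true true n) r =1 id.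
  move=> rR x; have rL := RL r rR.
  have r1 := R1 r rR.
have AB v : v \in A -> v \in B -> false by move=> vA; rewrite (disjointFr AB0 vA).
  have indepA v w : v \in [:: a; b; c] -> w \in [:: a; b; c] ->
      [set v; w] \notin edges Gam.
    move=> /abcA vA /abcA wA; apply/negP => /edge_cross [[_ /(AB w wA)]|[/(AB v vA)]] //.
  have indepB v w : v \in [:: a'; b'; c'] -> w \in [:: a'; b'; c'] ->
      [set v; w] \notin edges Gam.
    move=> /abcB vB /abcB wB; apply/negP.
    by move=> /edge_cross [[/AB/(_ vB)]|[_ /AB/(_ wB)]].
  have neqAB v w : v \in A -> w \in B -> (v == w) = false.
    by move=> vA wB; apply/eqP => vw; move: (AB v vA); rewrite vw => /(_ wB).
  have neqBA v w : v \in A -> w \in B -> (w == v) = false.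
    by rewrite eq_sym; apply: neqAB.
  have [act [act1 actM actE]] := triple_action (@swapK 0%R) indepA.
  have [act' [act1' actM' actE']] := triple_action (@swapK n) indepB.
  have [xn|xn] := ltnP (`|x| + size r) n.
    have [-> _] := wact_near xn.
    rewrite -(act_weval act1 actM (letter_moveK true false n) (f := f)) ?r1 //.
    move=> [[] []] y; rewrite /= ?actM !actE /triple_move ?eqxx.
    - by rewrite !neqBA.
    - by rewrite ca cb.
    - by rewrite ba !neqBA.
    - by rewrite !neqBA.
  have /(wact_far n) [-> _] : size r + 1 < `|x|%N.
    by clear -xn rL nE; lia.
  rewrite -(act_weval act1' actM' (letter_moveK false true n) (f := f)) ?r1 //.
  move=> [[] []] y; rewrite /= ?actM' !actE' /triple_move ?eqxx.
  - by rewrite ca' cb'.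
  - by rewrite !neqAB.
  - by rewrite ba' !neqAB.
  - by rewrite !neqAB.
have killed w : weval f w = 1 -> wact (letter_move true true n) w =1 id.
  by move=> /RC; apply: (wact_pres_eq (letter_moveK true true n) kill).
pose far k := weval f (conj_word k).
have farP k : (forall v, v \in A -> commute (cgen v) (far k)) /\ far k * far k = 1.
  elim: k => [|k [farC far2]].
    by rewrite /far /= mulg1 cgen2; split=> // v vA; apply: comm.
  pose z := cgen b' * far k * cgen b'.
  have zC v : v \in A -> commute (cgen v) z.
    by move=> vA; apply: commuteM (comm _ _ vA bB); apply: commuteM (comm _ _ vA bB) (farC v vA).
  have -> : far k.+1 = cgen a' * z * cgen a'.
    rewrite /far /= weval_cat /= /leval /= -/(far k) mulg1.
    rewrite -(sandwich (comm _ _ aA aB) (zC _ aA) (cgen2 _)) /z.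
    by rewrite -(sandwich (comm _ _ bA bB) (farC _ bA) (cgen2 _)) !mulgA.
  split=> [v vA|].
    by apply: commuteM (comm _ _ vA aB); apply: commuteM (comm _ _ vA aB) (zC v vA).
  by rewrite /z !mulgA !(mulg_mid (cgen2 _)) (mulg_mid far2) !(mulg_mid (cgen2 _)) cgen2.
pose w := ((true, false), true) :: conj_word n.-1 ++ ((true, false), true) :: conj_word n.-1.
have /killed/(_ 0%R) : weval f w = 1.
  rewrite /= weval_cat /= /leval /= -/(far _) mulgA {1}((farP _).1 _ cA).
  by rewrite -mulgA (mulgA (cgen c)) cgen2 mul1g (farP _).2.
rewrite /= wact_cat /= !wact_conj_word.
by rewrite (_ : n%:Z - n.-1%:Z = 1)%R //; clear -nE; lia.
Qed.
End Incoherence.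

(** * Noetherian subgroups *)

Definition noetherian (G : groupType) (P : G -> Prop) :=
  forall A : G -> Prop, is_subgroup A -> (forall x, A x -> P x) ->
  exists2 s : seq G, forall x, x \in s -> A x &
    forall x, A x -> generated (fun y => y \in s) x.

Lemma noetherian_sub (G : groupType) (P Q : G -> Prop) :
  (forall x, P x -> Q x) -> noetherian Q -> noetherian P.
Proof. by move=> PQ nQ A sA AP; apply: nQ => // x /AP /PQ. Qed.

Lemma noetherian1 (G : groupType) : noetherian (fun x : G => x = 1).
Proof.
move=> A [A1 _ _] AP; exists [::] => // x /AP ->; exact: generated1.
Qed.

Section Extension.
Variables (G : groupType) (A : G -> Prop) (x : G).
Notation N := (generated A).
Hypothesis noethN : noetherian N.
Hypothesis normx : forall a, A a -> N (x * a * x^-1) /\ N (x^-1 * a * x).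

Lemma norm_generated n : N n -> N (x * n * x^-1) /\ N (x^-1 * n * x).
Proof.
move=> Nn; split; move: n Nn; apply: generated_sub => [|a /normx []] //.
  by have := is_subgroup_conj x^-1 (generated_subgroup A); rewrite invgK.
by apply: is_subgroup_conj; apply: generated_subgroup.
Qed.

Lemma norm_exp i n : N n -> N (x ^+ i * n * x ^- i) /\ N (x ^- i * n * x ^+ i).
Proof.
move=> Nn; elim: i => [|i [IH1 IH2]]; first by rewrite !gnorm.
have [IH3 _] := norm_generated IH1; have [_ IH4] := norm_generated IH2.
split; first by rewrite expgS invgM; rewrite !mulgA in IH3 *.
by rewrite expgSr invgM; rewrite !mulgA in IH4 *.
Qed.

Lemma generated_cyclic_ext g : generated (fun y => A y \/ y = x) g ->
  exists n i j, N n /\ g = n * (x ^+ i * x ^- j).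
Proof.
have comm i j : commute (x ^+ i) (x ^- j) by apply/commuteV/commuteX2/commute_refl.
have normij i j n : N n -> N ((x ^+ i * x ^- j) * n * (x ^+ i * x ^- j)^-1).
  move=> Nn; have [Nn' _] := norm_exp i (norm_exp j Nn).2.
  by rewrite invgM invgK; rewrite !mulgA in Nn' *.
move: g; apply: generated_sub => [|g [Ag|->]]; last 2 first.
- by exists g, 0, 0; split; [apply: generated_in|rewrite !gnorm].
- by exists 1, 1%N, 0; split; [apply: generated1|rewrite expg1 expg0 !gnorm].
split.
- by exists 1, 0, 0; split; [apply: generated1|rewrite !gnorm].
- move=> _ _ [n [i [j [Nn ->]]]] [m [k [l [Nm ->]]]].
  exists (n * ((x ^+ i * x ^- j) * m * (x ^+ i * x ^- j)^-1)), (i + k), (l + j).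
  split; first by apply: generatedM => //; apply: normij.
  rewrite !expgnDr invgM -!mulgA; congr (_ * (_ * (_ * (_ * _)))).
  by rewrite invgK mulKg invgM (mulgA (x ^+ k)) (comm k j) -!mulgA mulVKg.
- move=> _ [n [i [j [Nn ->]]]].
  exists ((x ^+ j * x ^- i) * n^-1 * (x ^+ j * x ^- i)^-1), j, i.
  split; first by apply/normij/generatedV.
  by rewrite mulgVK !invgM invgK.
Qed.

(** Extension by a cyclic group: a subgroup [B] is generated by generators of its
    intersection with [N] together with one element n0 x^d, where d > 0 is the
    least exponent that occurs in [B]; every other exponent is reduced by
    subtracting d. *)
Lemma noetherian_cyclic_ext : noetherian (generated (fun y => A y \/ y = x)).
Proof.
move=> B /[dup] sB [B1 BM BV] BA.
have [s0 s0B gen0] := noethN (is_subgroup_meet sB (generated_subgroup A))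
  (fun y By => By.2).
have exponent g : B g -> exists n i, [/\ N n, B (n * x ^+ i) &
    g = n * x ^+ i \/ g^-1 = n * x ^+ i].
  move=> /[dup] Bg /BA/generated_cyclic_ext [n [i [j [Nn gE]]]].
  have [ji|/ltnW ij] := leqP j i.
    have gE' : g = n * x ^+ (i - j) by rewrite expgnFr.
    by exists n, (i - j); rewrite -gE'; split=> //; left.
  have gE' : g^-1 = x ^+ (j - i) * n^-1 * x ^- (j - i) * x ^+ (j - i).
    by rewrite mulgVK gE expgnFr // !invgM invgK.
  exists (x ^+ (j - i) * n^-1 * x ^- (j - i)), (j - i).
  rewrite -gE'; split; [|exact: BV|by right].
  by apply: (norm_exp _ (generatedV Nn)).1.
pose Q d := `[< 0 < d /\ exists2 n, N n & B (n * x ^+ d) >].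
have [[d Qd]|noQ] := pselect (exists d, Q d); last first.
  exists s0 => [y /s0B [] //|g Bg]; apply: gen0; split=> //.
  have [n [[|i] [Nn Bi gE]]] := exponent g Bg; last first.
    by case: noQ; exists i.+1; apply/asboolP; split=> //; exists n.
  rewrite expg0 mulg1 in gE; case: gE => [->|gE] //.
  by rewrite -[g]invgK gE; apply: generatedV.
case: (ex_minnP (ex_intro _ d Qd)) => {d Qd} d /asboolP [d0 [n0 Nn0 Bd]] dmin.
pose s := n0 * x ^+ d :: s0; exists s => [y|g Bg].
  by rewrite inE => /orP [/eqP ->|/s0B []].
have gens n i : N n -> B (n * x ^+ i) -> generated (fun y => y \in s) (n * x ^+ i).
  elim/ltn_ind: i n => i IH n Nn Bi.
  have [di|id] := leqP d i; last first.
    have i0 : i = 0.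
      apply/eqP; rewrite eqn0Ngt; apply: contraTN id => i0; rewrite -leqNgt.
      by apply: dmin; apply/asboolP; split=> //; exists n.
    apply: (generated_mono (A := fun y => y \in s0)) => [y ys|].
      by rewrite inE ys orbT.
    by apply: gen0; split=> //; rewrite i0 expg0 mulg1.
  have E : n * x ^+ i / (n0 * x ^+ d) =
      n * (x ^+ (i - d) * n0^-1 * x ^- (i - d)) * x ^+ (i - d).
    by rewrite !mulgA mulgVK expgnFr // invgM !mulgA.
  rewrite -[n * _](mulgVK (n0 * x ^+ d)); apply: generatedM; last first.
    by apply: generated_in; rewrite inE eqxx.
  rewrite E; apply: IH; first by rewrite ltn_subrL d0 (leq_trans d0).
    by apply: generatedM Nn _; apply: (norm_exp _ (generatedV Nn0)).1.
  by rewrite -E; apply: BM => //; apply: BV.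
have [n [i [Nn Bi [->|gE]]]] := exponent g Bg; first exact: gens.
by rewrite -[g]invgK gE; apply/generatedV/gens.
Qed.

End Extension.

(** * Paths in a graph of groups *)

Section Paths.
Variables (I : eqType) (P : Type) (src tgt : I -> P) (E : seq I).

(** The values of the paths from [p] to [q] with [n] edges in a graph of groups
    whose vertex groups and edge elements are realised in a single group [T].
    The same graph is used twice below: with values in the subgroup under study,
    and with values in a presented group that maps onto it. *)
Inductive gpath (T : groupType) (D : P -> T -> Prop) (t : I -> T) :
    P -> P -> nat -> T -> Prop :=
| gpath0 p d : D p d -> gpath D t p p 0 d
| gpathS e d x q n : e \in E -> D (src e) d -> gpath D t (tgt e) q n x ->
    gpath D t (src e) q n.+1 (d * t e * x).

Definition joined (T : groupType) (D : P -> T -> Prop) (t : I -> T) p q x :=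
  exists n, gpath D t p q n x.

Section Composition.
Variables (T : groupType) (D : P -> T -> Prop) (t : I -> T).
Hypothesis sD : forall p, is_subgroup (D p).

Lemma joined0 p d : D p d -> joined D t p p d.
Proof. by move=> Dd; exists 0; apply: gpath0. Qed.

Lemma joined1 p : joined D t p p 1.
Proof. by apply: joined0; case: (sD p). Qed.

Lemma gpath_mull p q n d x :
  D p d -> gpath D t p q n x -> gpath D t p q n (d * x).
Proof.
move=> Dd px; case: px Dd => {p q n x} [p d' Dd' Dd|e d' x q n eE Dd' px Dd].
  by apply: gpath0; case: (sD p) => _ DM _; apply: DM.
by rewrite !mulgA; apply: gpathS => //; case: (sD (src e)) => _ DM _; apply: DM.
Qed.

Lemma joined_cat p q r x y :
  joined D t p q x -> joined D t q r y -> joined D t p r (x * y).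
Proof.
move=> [n px]; elim: px => {p q n x} [p d Dd [m qy]|e d x q n eE Dd _ IH /IH [m qy]].
  by exists m; apply: gpath_mull.
by exists m.+1; rewrite -mulgA; apply: gpathS.
Qed.

Lemma joined_edge e : e \in E -> joined D t (src e) (tgt e) (t e).
Proof.
move=> eE; exists 1%N; rewrite -[t e]mulg1 -[t e]mul1g.
by apply: gpathS => //; [case: (sD (src e))|apply: gpath0; case: (sD (tgt e))].
Qed.

Variable bar : I -> I.
Hypothesis barE : forall e, e \in E ->
  [/\ bar e \in E, src (bar e) = tgt e, tgt (bar e) = src e &
      D (src e) (t e * t (bar e))].

(** The edges can be travelled backwards as soon as going along an edge and back
    yields an element of the vertex group. *)
Lemma joined_inv p q x : joined D t p q x -> joined D t q p x^-1.
Proof.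
have DV p' d : D p' d -> D p' d^-1 by case: (sD p') => _ _; apply.
move=> [n px]; elim: px => {p q n x} [p d Dd|e d x q n eE Dd _ IH].
  exact/joined0/DV.
rewrite !invgM; apply: joined_cat IH _.
have [be sb tb Dtt] := barE eE.
apply: (@joined_cat _ (src e)); last exact/joined0/DV.
have -> : (t e)^-1 = t (bar e) * (t e * t (bar e))^-1 by rewrite invgM mulVKg.
apply: (@joined_cat _ (src e)); last exact/joined0/DV.
by rewrite -sb -tb; apply: joined_edge.
Qed.

Lemma joined_subgroup p : is_subgroup (joined D t p p).
Proof.
split; [exact: joined1 | by move=> x y; apply: joined_cat | by move=> x; apply: joined_inv].
Qed.

End Composition.
End Paths.

(** * Double coset representatives *)

Lemma equivalence_rep (T : choiceType) (R : T -> T -> Prop) :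
    (forall x, R x x) -> (forall x y, R x y -> R y x) ->
    (forall x y z, R x y -> R y z -> R x z) ->
  exists2 r : T -> T, forall x, R x (r x) & forall x y, R x y -> r x = r y.
Proof.
move=> Rr Rs Rt; exists (fun x => choose (fun y => `[< R x y >]) x) => [x|x y xy].
  by apply/asboolP; apply: (chooseP (P := fun y => `[< R x y >])); apply/asboolP.
have eqR : (fun z => `[< R x z >]) =1 (fun z => `[< R y z >]).
  by move=> z; apply/asboolP/asboolP; apply: Rt => //; apply: Rs.
rewrite (eq_choose eqR); apply: choose_id; apply/asboolP => //.
exact: Rs.
Qed.

Section DoubleCosets.
Variables (G : groupType) (S H : G -> Prop).
Hypotheses (sS : is_subgroup S) (sH : is_subgroup H).

Lemma double_coset_rep : exists r : G -> G,
  (forall g, exists s h, [/\ S s, H h & g = s * r g * h]) /\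
  (forall s g h, S s -> H h -> r (s * g * h) = r g).
Proof.
have [S1 SM SV] := sS; have [H1 HM HV] := sH.
have [|x y|x y z|r rP rE] := @equivalence_rep G
    (fun x y => exists s h, [/\ S s, H h & x = s * y * h]).
- by move=> x; exists 1, 1; rewrite mul1g mulg1.
- move=> [s [h [Ss Hh ->]]]; exists s^-1, h^-1; split; [exact: SV|exact: HV|].
  by rewrite !gnorm.
- move=> [s [h [Ss Hh ->]]] [s' [h' [Ss' Hh' ->]]].
  by exists (s * s'), (h' * h); split; [exact: SM|exact: HM|rewrite !mulgA].
by exists r; split=> [//|s g h Ss Hh]; apply: rE; exists s, h.
Qed.

End DoubleCosets.

(** The vertices of the quotient of the tree by [S] are the double cosets S g H
    and its edges are the double cosets S g K.  Representatives are chosen so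
    that the representative of an edge starts at the representative of a vertex:
    this is the last property. *)
Lemma nested_double_coset_reps (G : groupType) (S H K : G -> Prop) :
    is_subgroup S -> is_subgroup H -> is_subgroup K ->
    (forall x, K x -> H x) ->
  exists vr er : G -> G,
    [/\ forall g, exists s h, [/\ S s, H h & g = s * vr g * h],
        forall s g h, S s -> H h -> vr (s * g * h) = vr g,
        forall g, exists s k, [/\ S s, K k & g = s * er g * k],
        forall s g k, S s -> K k -> er (s * g * k) = er g &
        forall g, H ((vr g)^-1 * er g)].
Proof.
move=> sS sH sK KH; have [S1 SM SV] := sS.
have [vr [vrP vrE]] := double_coset_rep sS sH.
have [r [rP rE]] := double_coset_rep sS sK.
have /choice [c cP] g : exists s, S s /\ H ((vr g)^-1 * s^-1 * g).
  by have [s [h [Ss Hh gE]]] := vrP g; exists s; rewrite {2}gE !gnorm.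
have vr_r g : vr (r g) = vr g.
  have [s [k [Ss Kk {2}->]]] := rP g.
  by rewrite vrE //; apply: KH.
exists vr, (fun g => (c (r g))^-1 * r g); split=> //.
- move=> g; have [s [k [Ss Kk gE]]] := rP g.
  exists (s * c (r g)), k; split=> //; first by apply: SM => //; case: (cP (r g)).
  by rewrite {1}gE !gnorm.
- by move=> s g k Ss Kk; rewrite rE.
- by move=> g; rewrite mulgA -vr_r; case: (cP (r g)).
Qed.

(** * Coherence of amalgamated products *)

(** Coherence of [H], with finitely generated subgroups given by generating
    families. *)
Definition coherent_in (G : groupType) (H : G -> Prop) :=
  forall (X : finType) (f : X -> G), (forall x, H (f x)) -> finitely_related f.

Lemma subgroupV (G : groupType) (P : G -> Prop) x :
  is_subgroup P -> P x^-1 -> P x.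
Proof. by case=> _ _ PV /PV; rewrite invgK. Qed.

Definition trivial_words (X : eqType) (G : groupType) (f : X -> G) (R : seq (word X)) :=
  forall r, r \in R -> weval f r = 1.

(** Finitely many conditions, each of which is enforced by finitely many
    relators, are enforced together by finitely many relators. *)
Lemma collect_relators (X J : eqType) (G : groupType) (f : X -> G) (s : seq J)
    (C : J -> seq (word X) -> Prop) :
    (forall j, j \in s -> exists2 R0, trivial_words f R0 &
       forall R, {subset R0 <= R} -> C j R) ->
  exists2 R0, trivial_words f R0 &
    forall R, {subset R0 <= R} -> forall j, j \in s -> C j R.
Proof.
elim: s => [|j s IH] Cs; first by exists [::].
have [|R1 R1f R1C] := IH; first by move=> i si; apply: Cs; rewrite inE si orbT.
have [|R0 R0f R0C] := Cs j; first by rewrite inE eqxx.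
exists (R0 ++ R1) => [r|R subR i].
  by rewrite mem_cat => /orP [/R0f|/R1f].
rewrite inE => /orP [/eqP ->|]; [apply: R0C|apply: R1C] => r rR;
by apply: subR; rewrite mem_cat rR ?orbT.
Qed.

Section Amalgam.
Variables (G : groupType) (H K : G -> Prop) (v : G).
Hypotheses (sH : is_subgroup H) (sK : is_subgroup K).
Hypothesis KH : forall x, K x -> H x.
Hypotheses (v2 : v * v = 1) (vK : forall k, K k -> commute v k).

(** What is needed of the normal form in the amalgam of [H] and K x <v> over [K]:
    [G] acts on words of cosets of [K], with [H] fixing the empty word [eps], and
    [hd y g] says that the word [y] starts with the coset gK.  In terms of the
    tree, the word is the path from the base vertex to a vertex, and its first
    letter tells along which edge the path leaves. *)
Variables (Y : Type) (act : G -> Y -> Y) (eps : Y) (hd : Y -> G -> Prop).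
Hypotheses (act1 : act 1 =1 id)
  (actM : forall g h y, act (g * h) y = act g (act h y))
  (act_eps : forall h, H h -> act h eps = eps)
  (hd_eps : forall g, ~ hd eps g)
  (hd_act : forall h y g, H h -> hd y g -> hd (act h y) (h * g))
  (hd_v : forall y, ~ hd y 1 -> hd (act v y) 1)
  (hd_inj : forall y g g', hd y g -> hd y g' -> K (g^-1 * g')).

Section SubgroupGraph.
Variables (S : G -> Prop) (vr er : G -> G).
Hypothesis sS : is_subgroup S.
Hypotheses (vrP : forall g, exists s h, [/\ S s, H h & g = s * vr g * h])
  (vrE : forall s g h, S s -> H h -> vr (s * g * h) = vr g)
  (erP : forall g, exists s k, [/\ S s, K k & g = s * er g * k])
  (erE : forall s g k, S s -> K k -> er (s * g * k) = er g)
  (er_vr : forall g, H ((vr g)^-1 * er g)).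

(** The representative [e] is an edge of the tree starting in eH; [star e] is the
    representative of the same edge with the opposite orientation. *)
Definition star e := er (e * v).

(** The element of [S] carrying the representative of the reversed edge to the
    reversed edge itself, up to [K]: the generator of [S] attached to the edge. *)
Variable sg : G -> G.
Hypothesis sgP : forall e, exists k, [/\ S (sg e), K k & e * v = sg e * star e * k].

(** The stabilizers in [S] of the vertex pH and of the edge e, both seen as
    subgroups of [G]. *)
Definition vstab p x := S x /\ H (p^-1 * x * p).
Definition estab e x := S x /\ K (e^-1 * x * e).

Lemma vstab_subgroup p : is_subgroup (vstab p).
Proof. by apply: is_subgroup_meet => //; apply: is_subgroup_conj. Qed.

Lemma Svr s g : S s -> vr (s * g) = vr g.
Proof. by move=> Ss; rewrite -[s * g]mulg1 vrE //; case: sH. Qed.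

Lemma vrH g h : H h -> vr (g * h) = vr g.
Proof. by move=> Hh; rewrite -[g in g * h]mul1g vrE //; case: sS. Qed.

Lemma Ser s g : S s -> er (s * g) = er g.
Proof. by move=> Ss; rewrite -[s * g]mulg1 erE //; case: sK. Qed.

Lemma erK g k : K k -> er (g * k) = er g.
Proof. by move=> Kk; rewrite -[g in g * k]mul1g erE //; case: sS. Qed.

Lemma er_id g : er (er g) = er g.
Proof. by have [s [k [Ss Kk {2}->]]] := erP g; rewrite erE. Qed.

Lemma vr_er g : vr (er g) = vr g.
Proof.
have [s [k [Ss Kk {2}->]]] := erP g.
by rewrite vrE //; apply: KH.
Qed.

Lemma vr_id g : vr (vr g) = vr g.
Proof. by have [s [h [Ss Hh {2}->]]] := vrP g; rewrite vrE. Qed.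

Lemma edge_src e : er e = e -> H ((vr e)^-1 * e).
Proof. by move=> {2}<-; apply: er_vr. Qed.

Lemma er_star e : er (star e) = star e.
Proof. exact: er_id. Qed.

Lemma vmulK g : g * v * v = g.
Proof. by rewrite -mulgA v2 mulg1. Qed.

Lemma starK e : er e = e -> star (star e) = e.
Proof.
have [_ _ SV] := sS; have [_ _ KV] := sK.
move=> ee; have [k [Ss Kk evE]] := sgP e.
have sE : star e * v = (sg e)^-1 * (e * k^-1).
  have -> : star e = (sg e)^-1 * (e * v) * k^-1 by rewrite evE !gnorm.
  by rewrite -!mulgA -(vK (KV _ Kk)) (mulgA v v) v2 mul1g.
rewrite {1}/star sE Ser ?erK //; [exact: KV | exact: SV].
Qed.

Lemma estab_vstab e x : er e = e -> estab e x -> vstab (vr e) x.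
Proof.
move=> /edge_src He [Sx Kx]; split=> //.
have [_ HM HV] := sH; have := HM _ _ (HM _ _ He (KH Kx)) (HV _ He).
by rewrite !gnorm.
Qed.

Lemma estab_sg e x : estab e x -> estab (star e) ((sg e)^-1 * x * sg e).
Proof.
have [_ SM SV] := sS; have [_ KM KV] := sK.
move=> [Sx Kx]; have [k [Ss Kk evE]] := sgP e.
split; first exact: SM (SM _ _ (SV _ Ss) Sx) Ss.
have sE : sg e * star e = e * v * k^-1 by rewrite evE !gnorm.
have -> : (star e)^-1 * ((sg e)^-1 * x * sg e) * star e =
    (sg e * star e)^-1 * x * (sg e * star e) by rewrite !gnorm.
have -> : (sg e * star e)^-1 * x * (sg e * star e) =
    k * (v^-1 * ((e^-1 * x * e) * v)) * k^-1 by rewrite sE !gnorm.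
by rewrite -(vK Kx) mulKg; apply: KM (KM _ _ _ _) _ => //; apply: KV.
Qed.

(** Going along an edge and back fixes that edge. *)
Lemma sg_star e : er e = e -> estab e (sg e * sg (star e)).
Proof.
have [_ SM SV] := sS; have [_ KM KV] := sK.
move=> ee; have [k [Ss Kk evE]] := sgP e; have [k' [Ss' Kk' evE']] := sgP (star e).
split; first exact: SM.
rewrite starK // in evE'.
have -> : sg e = e * v * k^-1 * (star e)^-1 by rewrite evE !gnorm.
have -> : sg (star e) = star e * v * k'^-1 * e^-1 by rewrite evE' !gnorm.
by rewrite !gnorm (vK (KV _ Kk)) vmulK; apply: KM; apply: KV.
Qed.

(** A finite subgraph of the quotient graph. *)
Definition edge_set (E : seq G) := forall e, e \in E -> er e = e /\ star e \in E.

Section Reduction.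
Variable E : seq G.
Hypothesis EP : edge_set E.
Variables (T : groupType) (theta : T -> G).
Hypothesis thetaM : forall x y, theta (x * y) = theta x * theta y.
Variables (D : G -> T -> Prop) (t : G -> T).
Hypotheses (sD : forall p, is_subgroup (D p))
  (thetaD : forall p x, D p x -> vstab p (theta x))
  (theta_t : forall e, e \in E -> theta (t e) = sg e)
  (conjD : forall e d, e \in E -> D (vr e) d -> estab e (theta d) ->
     D (vr (star e)) ((t e)^-1 * d * t e))
  (loopD : forall e, e \in E -> D (vr e) (t e * t (star e))).

Notation path := (gpath vr (vr \o star) E D t).

(** A path from [p] to [q] either has length 0, up to shortening, or moves the
    vertex so that the word of its endpoint starts with its own first edge.
    Indeed adding an edge in front of a path of the second kind prepends a letter,
    unless that edge followed by the first edge of the path is a backtracking; in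
    that case the two edges are opposite representatives, separated by an
    element of the edge group, and the product of the three is an element of the
    vertex group, which is absorbed by the rest of the path. *)
Lemma path_reduce n p q x : path p q n x ->
  D p x /\ p = q \/ exists e d x' m,
    [/\ e \in E, vr e = p, D p d &
        hd (act (p^-1 * theta x * q) eps) (p^-1 * theta d * e)] /\
    [/\ path (vr (star e)) q m x', m < n & x = d * t e * x'].
Proof.
elim/ltn_ind: n p q x => n IH p q x px.
case: px IH => {p q n x} [p d Dd|e d x q n eE Dd px] IH; first by left.
have [ee sE] := EP eE; have [k [Ss Kk evE]] := sgP e.
have [_ HM HV] := sH; have [_ KM KV] := sK.
have sgE : sg e = e * v * k^-1 * (star e)^-1 by rewrite evE !gnorm.
(* Seen from [p], the path crosses its first edge by [v], between the changes of
   base point [h2] before the edge and [h1] after it. *)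
pose h1 := k^-1 * (star e)^-1 * vr (star e).
pose h2 := (vr e)^-1 * theta d * e.
have Hh1 : H h1.
  rewrite /h1 -mulgA; apply: HM; first exact/KH/KV.
  by apply: (subgroupV sH); rewrite invgM invgK; apply/edge_src/er_star.
have Hh2 : H h2.
  have [_ Hd] := thetaD Dd; have := HM _ _ Hd (edge_src ee).
  by rewrite /h2 !gnorm.
have yE : (vr e)^-1 * theta (d * t e * x) * q =
    h2 * (v * (h1 * ((vr (star e))^-1 * theta x * q))).
  by rewrite !thetaM theta_t // sgE /h1 /h2 !gnorm.
set y' := act ((vr (star e))^-1 * theta x * q) eps.
have prepend : ~ hd (act h1 y') 1 -> hd (act ((vr e)^-1 * theta (d * t e * x) * q) eps) h2.
  by move=> nhd; have := hd_act Hh2 (hd_v nhd); rewrite mulg1 yE (actM h2) (actM v) (actM h1).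
have [[Dx eq]|[e' [d' [x' [m [[e'E e's Dd' hd'] [px' mn xE]]]]]]] := IH n (ltnSn n) _ _ _ px.
  right; exists e, d, x, n; split=> //; split=> //; apply: prepend.
  rewrite /y' -eq act_eps; first by rewrite act_eps // => /hd_eps.
  by case: (thetaD Dx).
have [hd1|nhd] := pselect (hd (act h1 y') 1); last first.
  by right; exists e, d, x, n; split=> //; split=> //; apply: prepend.
have [e'e' _] := EP e'E.
have Kb : K ((star e)^-1 * theta d' * e').
  have := hd_act (HV _ Hh1) hd1; rewrite mulg1 -actM mulVg act1 => hd1'.
  have := hd_inj hd1' hd'; rewrite /h1 !gnorm => Kb.
  by have := KM _ _ Kk Kb; rewrite !gnorm.
have e'E' : e' = star e.
  rewrite -e'e' -er_star -(erK (star e) Kb) !mulgA mulgV mul1g Ser //.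
  by case: (thetaD Dd').
subst e'; have Dd'' : D (vr e) (t e * d' * t (star e)).
  have -> : t e * d' * t (star e) =
      t e * t (star e) * ((t (star e))^-1 * d' * t (star e)) by rewrite !gnorm.
  have [_ DM _] := sD (vr e); apply: DM; first exact: loopD.
  rewrite -{1}(starK ee); apply: conjD => //; split=> //.
  by case: (thetaD Dd').
have {}px' : path (vr e) q m (d * (t e * d' * t (star e)) * x').
  rewrite -mulgA; apply: gpath_mull => //; apply: gpath_mull => //.
  by move: px'; rewrite starK.
have -> : d * t e * x = d * (t e * d' * t (star e)) * x' by rewrite xE !mulgA.
have [|//|[e1 [d1 [x1 [m1 [? [? m1m ?]]]]]]] := IH m _ _ _ _ px'.
- by apply: ltn_trans mn _.
- by left.
- right; exists e1, d1, x1, m1; split=> //; split=> //.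
  by apply: ltn_trans m1m _; apply: ltn_trans mn _.
Qed.

(** A path of positive length with trivial value would give the empty word a first
    letter. *)
Lemma trivial_path p x : joined vr (vr \o star) E D t p p x -> theta x = 1 -> D p x.
Proof.
move=> [n /path_reduce [[]//|[e [d [x' [m [[_ _ _ hdx] _]]]]]]] x1.
by move: hdx; rewrite x1 mulg1 mulVg act1 => /hd_eps.
Qed.

End Reduction.


Definition linked (E : seq G) := joined vr (vr \o star) E vstab sg.

Lemma linked_in E p q x : linked E p q x -> S x.
Proof.
have [_ SM _] := sS; case=> n; elim=> {p q n x} [p d []//|e d x q n _ [Sd _] _ Sx].
by have [k [Ss _ _]] := sgP e; apply: (SM) Sx; apply: (SM).
Qed.

Lemma linked_bar E : edge_set E ->
  forall e, e \in E -> [/\ star e \in E, vr (star e) = (vr \o star) e,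
    (vr \o star) (star e) = vr e & vstab (vr e) (sg e * sg (star e))].
Proof.
move=> EP e /EP [ee sE]; split=> //=; first by rewrite starK.
by apply: estab_vstab => //; apply: sg_star.
Qed.

(** The vertex gH of the tree is reached from [b] by a path whose edges have their
    orbits in [E]. *)
Definition reaches E b g := exists2 x, linked E b (vr g) x & H ((x * vr g)^-1 * g).

Lemma reachesH E b g h : H h -> reaches E b g -> reaches E b (g * h).
Proof.
move=> Hh [x lx Hx]; exists x; rewrite vrH //.
by rewrite mulgA; have [_ HM _] := sH; apply: HM.
Qed.

Lemma reachesv E b g : er g \in E -> reaches E b g -> reaches E b (g * v).
Proof.
have [_ SM SV] := sS; have [_ HM HV] := sH; have [_ KM KV] := sK.
move=> eE [x lx Hx]; have [s [k [Ss Kk gE]]] := erP g.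
have [k' [Ssg Kk' evE]] := sgP (er g).
have gvE : g * v = s * sg (er g) * star (er g) * (k' * k).
  by rewrite {1}gE -!mulgA -(vK Kk) (mulgA (er g) v) evE !mulgA.
have Hk : H (k' * k) by apply/KH/KM.
have vrgv : vr (g * v) = vr (star (er g)).
  by rewrite gvE vrH // Svr //; apply: (SM).
have Sx := linked_in lx.
have Vxs : vstab (vr (er g)) (x^-1 * s).
  split; first by apply: (SM) => //; apply: SV.
  rewrite vr_er; have := HM _ _ (HM _ _ Hx (HV _ (KH Kk))) (HV _ (er_vr g)).
  by rewrite {2}gE !gnorm.
exists (x * ((x^-1 * s) * sg (er g))).
  rewrite vrgv; apply: joined_cat vstab_subgroup _ _ _ _ _ lx _.
  rewrite -vr_er; apply: (joined_cat vstab_subgroup (q := vr (er g))).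
    exact: joined0.
  exact: (joined_edge vr (vr \o star) sg vstab_subgroup eE).
rewrite vrgv gvE -!mulgA mulVKg !invgM !mulgA.
have := HM _ _ (edge_src (er_star (er g))) Hk.
by rewrite !gnorm.
Qed.

(** Follow a word in [H] and [v] through the tree: letters in [H] do not move the
    vertex, and each [v] crosses one edge; these edges form the list [E0]. *)
Lemma walk b (w : word G) : (forall l, l \in w -> H l.1 \/ l.1 = v) ->
  forall g, exists2 E0 : seq G, forall e, e \in E0 -> er e = e &
    forall E, {subset E0 <= E} -> reaches E b g ->
      reaches E b (g * weval id w) /\
      forall e, e \in E0 -> exists x, linked E b (vr e) x.
Proof.
elim: w => [|l w IH] wHv g.
  by exists [::] => // E _ rg; rewrite mulg1.
have [|E0 E0P walkE] := IH _ (g * leval id l).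
  by move=> l' l'w; apply: wHv; rewrite inE l'w orbT.
have [Hl|lv] : H (leval id l) \/ leval id l = v.
  have := wHv l; rewrite inE eqxx => /(_ isT).
  case: l {wHv walkE} => y [] /= [Hy|->]; rewrite /leval /=; auto.
    by left; case: sH => _ _; apply.
  by right; apply: (mulgI v); rewrite mulgV v2.
- exists E0 => // E E0E rg; rewrite /= mulgA; apply: walkE => //.
  exact: reachesH.
- exists (er g :: E0) => [e|E E0E rg].
    by rewrite inE => /orP [/eqP ->|/E0P //]; apply: er_id.
  have rgv : reaches E b (g * leval id l).
    by rewrite lv; apply: reachesv => //; apply: E0E; rewrite inE eqxx.
  have [|rgw E0e] := walkE E _ rgv.
    by move=> e eE0; apply: E0E; rewrite inE eE0 orbT.
  rewrite /= mulgA; split=> // e; rewrite inE => /orP [/eqP ->|]; last exact: E0e.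
  by rewrite vr_er; case: rg => x lx _; exists x.
Qed.


Variables (I : finType) (f : I -> G).
Hypothesis f_gen : forall i, generated (fun y => H y \/ y = v) (f i).
Hypothesis S_f : forall x, S x <-> generated (fun y => exists i, y = f i) x.

(** Walking along b^-1 s b from the vertex bH, for the generators [s] of [S],
    crosses finitely many edges.  For any subgraph [E] containing them, the values
    of the closed paths at [b] form a subgroup containing the generators, hence
    all of [S]; in particular the value of a path from [b] to another vertex can
    be corrected to be 1. *)
Lemma finite_core : exists b E,
  [/\ edge_set E, forall x, S x -> linked E b b x &
      forall e, e \in E -> linked E b (vr e) 1].
Proof.
pose GHv := generated (fun y => H y \/ y = v).
have [_ GM GV] : is_subgroup GHv := generated_subgroup _.
have SG x : S x -> GHv x.
  move/S_f; apply: generated_sub; first exact: generated_subgroup.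
  by move=> _ [i ->].
have Sf i : S (f i) by apply/S_f/generated_in; exists i.
have [S1 SM SV] := sS; have [H1 HM HV] := sH.
pose b := vr 1; have bb : vr b = b by apply: vr_id.
have Gb : GHv b.
  have [s [h [Ss Hh E1]]] := vrP 1.
  have -> : b = s^-1 * h^-1.
    by apply: (mulgI s); apply: (mulIg h); rewrite -E1 !gnorm.
  by apply: GM; apply: GV; [apply: SG|apply: generated_in; left].
(* The edges crossed on the way from bH to (f i) bH. *)
have /choice [E0 E0P] i : exists E0 : seq G, (forall e, e \in E0 -> er e = e) /\
    forall E, {subset E0 <= E} ->
      linked E b b (f i) /\ forall e, e \in E0 -> exists x, linked E b (vr e) x.
  have /generated_weval [w wHv wE] : GHv (b^-1 * f i * b).
    exact: GM _ _ (GM _ _ (GV _ Gb) (f_gen i)) Gb.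
  have [E0 E0P walkE] := walk b wHv b.
  exists E0; split=> // E E0E.
  have rb : reaches E b b.
    by exists 1; [rewrite bb; apply: joined1 vstab_subgroup _|rewrite bb mul1g mulVg].
  have [[x lx Hx] lE] := walkE E E0E rb.
  split=> //; rewrite wE !gnorm in lx Hx.
  rewrite Svr // bb in lx Hx.
  have Vx : vstab b (x^-1 * f i).
    split; first by apply: (SM) => //; apply: SV; apply: linked_in lx.
    by move: Hx; rewrite !gnorm.
  rewrite -[f i](mulVKg x); apply: (joined_cat vstab_subgroup) lx _.
  exact: joined0.
pose E1 := flatten [seq E0 i | i <- enum I].
pose E := E1 ++ [seq star e | e <- E1].
have E1P e : e \in E1 -> exists2 i, e \in E0 i & er e = e.
  move/flatten_mapP => [i _ ei]; exists i => //.
  by case: (E0P i) => /(_ e ei).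
have EP : edge_set E.
  move=> e; rewrite mem_cat => /orP [eE1|/mapP [e1 e1E ->]].
    by have [i _ ->] := E1P e eE1; rewrite mem_cat map_f ?orbT.
  have [i _ ee] := E1P e1 e1E.
  by rewrite er_star starK // mem_cat e1E.
have E0E i : {subset E0 i <= E}.
  move=> e ei; rewrite mem_cat; apply/orP; left; apply/flatten_mapP.
  by exists i; rewrite ?mem_enum.
have linkS x : S x -> linked E b b x.
  move/S_f; apply: generated_sub.
    exact: (joined_subgroup vstab_subgroup (linked_bar EP)).
  by move=> _ [i ->]; case: (E0P i) => _ /(_ E (E0E i)) [].
exists b, E; split=> // e eE.
suff [x lx] : exists x, linked E b (vr e) x.
  rewrite -(mulVg x); apply: (joined_cat vstab_subgroup) (lx).
  by apply/linkS/SV; apply: linked_in lx.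
have link1 e1 : e1 \in E1 -> exists x, linked E b (vr e1) x.
  by case/E1P=> i ei _; case: (E0P i) => _ /(_ E (E0E i)) [_]; apply.
move: (eE); rewrite mem_cat => /orP [/link1 //|/mapP [e1 e1E ->]].
have [x lx] := link1 _ e1E; exists (x * sg e1).
apply: (joined_cat vstab_subgroup) lx _.
have e1E' : e1 \in E by rewrite mem_cat e1E.
exact: (joined_edge vr (vr \o star) sg vstab_subgroup e1E').
Qed.


(** The finitely generated part of the vertex group visible in the list [Z]. *)
Definition vgen (Z : seq G) p := generated (fun z => z \in Z /\ vstab p z).

(** The base vertex is listed separately, for the graph may have no edges. *)
Definition vertex_of (b : G) (E : seq G) p := p = b \/ exists2 e, e \in E & p = vr e.

(** A path involves finitely many elements of the vertex groups. *)
Lemma linked_support b E p q x : edge_set E -> vertex_of b E p -> linked E p q x ->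
  exists2 Z0 : seq G,
    forall z, z \in Z0 -> exists2 p', vertex_of b E p' & vstab p' z &
    forall Z, {subset Z0 <= Z} -> joined vr (vr \o star) E (vgen Z) sg p q x.
Proof.
move=> EP pV [n]; move: pV => /[swap]; elim=> {p q n x} [p d Vd pV|e d x q n eE Vd _ IH pV].
  exists [:: d] => [z /[1!inE] /eqP ->|Z dZ]; first by exists p.
  by apply/joined0/generated_in; split=> //; apply: dZ; rewrite inE.
have [|Z0 Z0P Z0l] := IH; first by right; exists (star e) => //; case: (EP e eE).
exists (d :: Z0) => [z /[1!inE] /orP [/eqP ->|/Z0P //]|Z dZ].
  by exists (vr e).
have [|m px] := Z0l Z; first by move=> z zZ; apply: dZ; rewrite inE zZ orbT.
exists m.+1; apply: gpathS => //; apply: generated_in; split=> //.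
by apply: dZ; rewrite inE eqxx.
Qed.

(** Construction of a finite presentation of [S] on the generators [Z], which
    consist of the elements attached to the edges and of elements of the vertex
    groups. *)
Section Relators.
Variables (b : G) (E Z : seq G).
Hypothesis EP : edge_set E.
Hypothesis Z_sg : forall e, e \in E -> sg e \in Z.
Hypothesis Z_cases : forall z, z \in Z ->
  (exists2 e, e \in E & z = sg e) \/ (exists2 p, vertex_of b E p & vstab p z).
Hypothesis Z_estab : forall e x, e \in E -> estab e x ->
  generated (fun z => z \in Z /\ estab e z) x.
Hypothesis Z_link : forall e, e \in E ->
  joined vr (vr \o star) E (vgen Z) sg b (vr e) 1.
Hypothesis cohH : coherent_in H.

Let X := seq_sub Z.
Let Xp p := {x : X | `[< vstab p (val x) >]}.
Let gx (x : X) : G := val x.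

Definition rgen (R : seq (word X)) (x : X) := pres_gen (fun r => r \in R) x.
Definition rvert (R : seq (word X)) p := generated (fun u => exists x : Xp p, u = rgen R (val x)).
Arguments rvert : clear implicits.
(** The empty word is a default value for edges whose element is not in [Z]. *)
Definition sword e : word X :=
  if insub (sg e) is Some x then [:: (x, true)] else [::].
Definition redge R e := weval (rgen R) (sword e).
Notation rjoined R := (joined vr (vr \o star) E (rvert R) (redge R)).

Lemma sword_eval e : e \in E -> weval gx (sword e) = sg e.
Proof.
by move=> /Z_sg sZ; rewrite /sword insubT /= mulg1.
Qed.

Lemma rvert_wmap R p (w : word (Xp p)) : rvert R p (weval (rgen R) (wmap val w)).
Proof. by apply/range_generated; exists w; rewrite weval_wmap. Qed.

Lemma vgen_word p x : vgen Z p x -> exists w : word (Xp p), weval gx (wmap val w) = x.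
Proof.
move=> Vx; have : generated (fun y => exists i : Xp p, y = gx (val i)) x.
  apply: generated_mono Vx => z [zZ Vz].
  have Vz' : `[< vstab p (val (SeqSub zZ)) >] by apply/asboolP.
  by exists (exist (fun x : X => `[< vstab p (val x) >]) (SeqSub zZ) Vz').
by case/range_generated => w ->; exists w; rewrite weval_wmap.
Qed.

Lemma joined_word p q x : joined vr (vr \o star) E (vgen Z) sg p q x ->
  exists2 w : word X, weval gx w = x &
    forall R, rjoined R p q (weval (rgen R) w).
Proof.
case=> n; elim=> {p q n x} [p d /vgen_word [w <-]|e d x q n eE /vgen_word [w <-] _ [w' <- lw']].
  by exists (wmap val w) => // R; apply/joined0/rvert_wmap.
exists (wmap val w ++ sword e ++ w').
  by rewrite !weval_cat sword_eval // mulgA.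
move=> R; have [m px] := lw' R; exists m.+1.
by rewrite !weval_cat mulgA; apply: gpathS => //; apply: rvert_wmap.
Qed.

(** This is where the coherence of [H] is used: the visible part of a vertex group
    is conjugate to a finitely generated subgroup of [H]. *)
Lemma relators_vertex p : exists2 R0, trivial_words gx R0 &
  forall R, {subset R0 <= R} ->
    forall w : word (Xp p), weval gx (wmap val w) = 1 -> weval (rgen R) (wmap val w) = 1.
Proof.
have /finitely_related_conj [R1 R1f R1C] : finitely_related (fun x : Xp p => p^-1 * gx (val x) * p).
  by apply: cohH => x; case: (asboolP _ (valP x)).
exists [seq wmap val r | r <- R1] => [_ /mapP [r rR ->]|R R1R w].
  by rewrite weval_wmap; apply: R1f.
rewrite !weval_wmap => /R1C; apply: (weval_pres_eq (f := rgen R \o val)) => r rR1.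
rewrite -weval_wmap; apply/pres_class1/pres_relator/R1R.
exact: map_f.
Qed.

Lemma relators_link e : e \in E -> exists2 R0, trivial_words gx R0 &
  forall R, {subset R0 <= R} -> rjoined R b (vr e) 1.
Proof.
move=> /Z_link /joined_word [w w1 wl]; exists [:: w] => [r /[1!inE] /eqP -> //|R wR].
have -> // : 1 = weval (rgen R) w :> presented_group (fun r => r \in R).
by apply/esym/pres_class1/pres_relator/wR; rewrite inE.
Qed.

Lemma relator_rvert p (u : word X) : vgen Z p (weval gx u) ->
  exists2 R0, trivial_words gx R0 & forall R, {subset R0 <= R} -> rvert R p (weval (rgen R) u).
Proof.
case/vgen_word => w wu; exists [:: u ++ winv (wmap val w)] => [r /[1!inE] /eqP ->|R wR].
  by rewrite weval_cat weval_inv wu mulgV.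
suff -> : weval (rgen R) u = weval (rgen R) (wmap val w) by apply: rvert_wmap.
apply: divg1_eq; rewrite -weval_inv -weval_cat.
by apply/pres_class1/pres_relator/wR; rewrite inE.
Qed.

Lemma vgen_estab e x : e \in E -> estab e x -> vgen Z (vr e) x.
Proof.
move=> eE /(Z_estab eE); apply: generated_mono => z [zZ Ez]; split=> //.
by apply: estab_vstab Ez; case: (EP eE).
Qed.

Lemma relators_loop e : e \in E -> exists2 R0, trivial_words gx R0 &
  forall R, {subset R0 <= R} -> rvert R (vr e) (redge R e * redge R (star e)).
Proof.
move=> eE; have [ee sE] := EP eE.
have [|R0 R0f R0C] := @relator_rvert (vr e) (sword e ++ sword (star e)).
  by rewrite weval_cat !sword_eval //; apply/vgen_estab/sg_star.
by exists R0 => // R /R0C; rewrite weval_cat.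
Qed.

(** It suffices to impose the relation on generators of the edge group. *)
Lemma relators_conj e : e \in E -> exists2 R0, trivial_words gx R0 &
  forall R, {subset R0 <= R} -> forall x, x \in enum {: seq_sub Z} -> estab e (gx x) ->
    rvert R (vr (star e)) ((redge R e)^-1 * rgen R x * redge R e).
Proof.
move=> eE; have [ee sE] := EP eE; apply: collect_relators => x _.
have [Ex|nEx] := pselect (estab e (gx x)); last by exists [::].
have [|R0 R0f R0C] := @relator_rvert (vr (star e))
    (winv (sword e) ++ (x, true) :: sword e).
  rewrite weval_cat weval_inv /= sword_eval // mulgA.
  by apply: vgen_estab => //; apply: estab_sg.
by exists R0 => // R /R0C; rewrite weval_cat weval_inv /= mulgA.
Qed.

(** The four kinds of relators make the presented group a second realisation of
    the graph of groups, with its vertex groups mapped injectively to [G].  Every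
    generator is the value of a closed path at [b], hence so is every word; a word
    with trivial value reduces to an element of the vertex group of [b], where it
    is trivial by injectivity. *)
Lemma finitely_related_val : finitely_related gx.
Proof.
have [R1 R1f R1C] := collect_relators (s := b :: [seq vr e | e <- E])
  (fun p _ => relators_vertex p).
have [R2 R2f R2C] := collect_relators relators_link.
have [R3 R3f R3C] := collect_relators relators_loop.
have [R4 R4f R4C] := collect_relators relators_conj.
pose R := R1 ++ R2 ++ R3 ++ R4.
have Rf : trivial_words gx R.
  by move=> r; rewrite !mem_cat => /or4P [/R1f|/R2f|/R3f|/R4f].
have subR r n : r \in nth [::] [:: R1; R2; R3; R4] n -> r \in R.
  by case: n => [|[|[|[|[]]]]] //= rR; rewrite !mem_cat rR ?orbT.
have {}R1C p : vertex_of b E p -> forall w : word (Xp p),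
    weval gx (wmap val w) = 1 -> weval (rgen R) (wmap val w) = 1.
  move=> pV; apply: R1C; first by move=> r rR; rewrite !mem_cat rR.
  by case: pV => [->|[e eE ->]]; rewrite inE ?eqxx // map_f ?orbT.
have {}R2C := R2C R (fun r rR => subR r 1%N rR).
have {}R3C := R3C R (fun r rR => subR r 2 rR).
have {}R4C := R4C R (fun r rR => subR r 3 rR).
pose theta := pres_lift (R := fun r => r \in R) gx.
have thetaE w : theta (weval (rgen R) w) = weval gx w by apply: pres_lift_weval Rf w.
have thetaM : {morph theta : x y / x * y} := pres_liftM Rf.
have sD p : is_subgroup (rvert R p) by apply: generated_subgroup.
have rvertE p u : rvert R p u -> exists w : word (Xp p), u = weval (rgen R) (wmap val w).
  by case/range_generated => w ->; exists w; rewrite weval_wmap.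
have thetaD p u : rvert R p u -> vstab p (theta u).
  move/rvertE => [w ->]; rewrite thetaE weval_wmap.
  have : generated (fun y => exists i : Xp p, y = gx (val i)) (weval (gx \o val) w).
    by apply/range_generated; exists w.
  apply: generated_sub; first exact: vstab_subgroup.
  by move=> _ [x ->]; case: (asboolP _ (valP x)).
have theta_inj p u : vertex_of b E p -> rvert R p u -> theta u = 1 -> u = 1.
  by move=> pV /rvertE [w ->]; rewrite thetaE; apply: R1C.
have theta1 : theta 1 = 1 by apply: morph_group1.
have thetaV u : theta u^-1 = (theta u)^-1.
  by apply: (mulgI (theta u)); rewrite -thetaM !mulgV.
have theta_t e : e \in E -> theta (redge R e) = sg e.
  by move=> eE; rewrite thetaE sword_eval.
have conjD e d : e \in E -> rvert R (vr e) d -> estab e (theta d) ->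
    rvert R (vr (star e)) ((redge R e)^-1 * d * redge R e).
  move=> eE Dd Ed; have [_ DM DV] := sD (vr e).
  (* The elements of the edge group with a lift that satisfies the conclusion form
     a subgroup containing the generators, and lifts are unique. *)
  have [u [Du ud Cu]] : exists u, [/\ rvert R (vr e) u, theta u = theta d &
      rvert R (vr (star e)) ((redge R e)^-1 * u * redge R e)].
    move: (theta d) (Z_estab eE Ed); apply: generated_sub => [|z [zZ Ez]].
      have [D1 DM' DV'] := is_subgroup_conj (redge R e) (sD (vr (star e))).
      split.
      - by exists 1; split=> //; case: (sD (vr e)).
      - move=> _ _ [u [Du <- Cu]] [u' [Du' <- Cu']]; exists (u * u').
        by split; [exact: DM|exact: thetaM|exact: DM'].
      - move=> _ [u [Du <- Cu]]; exists u^-1.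
        by split; [exact: DV|exact: thetaV|exact: DV'].
    exists (rgen R (SeqSub zZ)); split; last by apply: R4C => //; rewrite mem_enum.
      have Vz : vstab (vr e) z by apply: estab_vstab Ez; case: (EP eE).
      have Vz' : `[< vstab (vr e) (val (SeqSub zZ)) >] by apply/asboolP.
      apply: generated_in.
      by exists (exist (fun x : X => `[< vstab (vr e) (val x) >]) (SeqSub zZ) Vz').
    by have := thetaE [:: (SeqSub zZ, true)]; rewrite /= !mulg1.
  suff <- : u = d by [].
  apply/divg1_eq; apply: (theta_inj (vr e)); first by right; exists e.
    by apply: DM => //; apply: DV.
  by rewrite thetaM thetaV ud mulgV.
have barE e : e \in E -> [/\ star e \in E, vr (star e) = (vr \o star) e,
    (vr \o star) (star e) = vr e & rvert R (vr e) (redge R e * redge R (star e))].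
  by move=> eE; have [ee sE] := EP eE; split=> //=; [rewrite starK|apply: R3C].
have link1 p : vertex_of b E p -> rjoined R b p 1.
  by case=> [->|[e eE ->]]; [apply: joined1|apply: R2C].
have link1V p : vertex_of b E p -> rjoined R p b 1.
  by move=> /link1 /(joined_inv sD barE); rewrite invg1.
(* Paths with value 1 from [b] to all vertices turn every generator into a closed
   path at [b]. *)
have gen_joined x : rjoined R b b (rgen R x).
  rewrite -[rgen R x]mulg1 -[rgen R x]mul1g.
  case: (Z_cases (valP x)) => [[e eE xe]|[p pV Vx]].
    have -> : rgen R x = redge R e.
      by rewrite /redge /sword -xe valK /= mulg1.
    have [_ sE] := EP eE.
    apply: (joined_cat sD) (link1V (vr (star e)) _); last by right; exists (star e).
    apply: (joined_cat sD) (link1 (vr e) _) _; first by right; exists e.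
    exact: (joined_edge vr (vr \o star) (redge R) sD eE).
  apply: (joined_cat sD) (link1V p pV); apply: (joined_cat sD) (link1 p pV) _.
  apply: joined0; apply: generated_in.
  have Vx' : `[< vstab p (val x) >] by apply/asboolP.
  by exists (exist (fun x : X => `[< vstab p (val x) >]) x Vx').
exists R => // w w1; apply/pres_class1.
have wD : rvert R b (weval (rgen R) w).
  apply: (trivial_path EP thetaM sD thetaD theta_t conjD R3C); last by rewrite thetaE.
  have : generated (fun y => exists x, y = rgen R x) (weval (rgen R) w).
    by apply/range_generated; exists w.
  by apply: (generated_sub (joined_subgroup sD barE b)) => _ [x ->].
by apply: theta_inj wD _; [left|rewrite thetaE].
Qed.

End Relators.


(** The edge group is conjugate to a subgroup of [K]. *)
Lemma estab_fg e : noetherian K ->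
  exists2 s : seq G, forall z, z \in s -> estab e z &
    forall x, estab e x -> generated (fun z => z \in s) x.
Proof.
move=> noethK; pose A x := K x /\ S (e * x * e^-1).
have sA : is_subgroup A.
  apply: is_subgroup_meet => //.
  by have := is_subgroup_conj e^-1 sS; rewrite invgK.
have [s sP gen_s] := noethK A sA (fun x Ax => Ax.1).
exists [seq e * x * e^-1 | x <- s] => [_ /mapP [x /sP [Kx Sx] ->]|x [Sx Kx]].
  by split; rewrite // !gnorm.
have Ax : A (e^-1 * x * e) by split; rewrite // !gnorm.
have -> : x = e * (e^-1 * x * e) * e^-1 by rewrite !gnorm.
move: (e^-1 * x * e) {Sx Kx} Ax => y /gen_s.
have := is_subgroup_conj e^-1
  (generated_subgroup (fun z => z \in [seq e * x * e^-1 | x <- s])).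
rewrite invgK => sgen; apply: (generated_sub sgen) => z zs.
by apply: generated_in; apply: (map_f (fun x => e * x * e^-1)).
Qed.

Lemma subgroup_finitely_related : noetherian K -> coherent_in H -> finitely_related f.
Proof.
move=> noethK cohH; have [b [E [EP linkS link1]]] := finite_core.
have bV : vertex_of b E b by left.
have /choice [Ze ZeP] e : exists s : seq G, (forall z, z \in s -> estab e z) /\
    forall x, estab e x -> generated (fun z => z \in s) x.
  by have [s] := estab_fg e noethK; exists s.
have /choice [Zl ZlP] e : exists Z0 : seq G,
    (forall z, z \in Z0 -> exists2 p', vertex_of b E p' & vstab p' z) /\
    (e \in E -> forall Z, {subset Z0 <= Z} ->
       joined vr (vr \o star) E (vgen Z) sg b (vr e) 1).
  have [/link1 l1|] := boolP (e \in E); last by exists [::].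
  by have [Z0] := linked_support EP bV l1; exists Z0.
have /choice [Zf ZfP] i : exists Z0 : seq G,
    (forall z, z \in Z0 -> exists2 p', vertex_of b E p' & vstab p' z) /\
    (forall Z, {subset Z0 <= Z} ->
       joined vr (vr \o star) E (vgen Z) sg b b (f i)).
  have Sfi : S (f i) by apply/S_f/generated_in; exists i.
  by have [Z0] := linked_support EP bV (linkS _ Sfi); exists Z0.
pose Z := [seq sg e | e <- E] ++ flatten [seq Ze e | e <- E] ++
  flatten [seq Zl e | e <- E] ++ flatten [seq Zf i | i <- enum I].
have Z_sg e : e \in E -> sg e \in Z by move=> eE; rewrite mem_cat map_f.
have Z_e e : e \in E -> {subset Ze e <= Z}.
  move=> eE z zZ; rewrite !mem_cat; apply/or4P; apply: Or42.
  by apply/flatten_mapP; exists e.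
have Z_l e : e \in E -> {subset Zl e <= Z}.
  move=> eE z zZ; rewrite !mem_cat; apply/or4P; apply: Or43.
  by apply/flatten_mapP; exists e.
have Z_f i : {subset Zf i <= Z}.
  move=> z zZ; rewrite !mem_cat; apply/or4P; apply: Or44.
  by apply/flatten_mapP; exists i; rewrite ?mem_enum.
have Z_cases z : z \in Z -> (exists2 e, e \in E & z = sg e) \/
    (exists2 p, vertex_of b E p & vstab p z).
  rewrite !mem_cat => /or4P [/mapP [e eE ->]|/flatten_mapP [e eE ze]|
    /flatten_mapP [e eE ze]|/flatten_mapP [i _ zi]].
  - by left; exists e.
  - right; exists (vr e); first by right; exists e.
    by apply: estab_vstab; [case: (EP e eE)|apply: (ZeP e).1].
  - by right; apply: (ZlP e).1.
  - by right; apply: (ZfP i).1.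
have ZS z : z \in Z -> S z.
  by case/Z_cases => [[e eE ->]|[p _ []] //]; have [k []] := sgP e.
have relZ : finitely_related (fun x : seq_sub Z => val x : G).
  apply: (finitely_related_val EP Z_sg Z_cases) => // [e x eE Ex|e eE].
    apply: generated_mono ((ZeP e).2 x Ex) => z zZ.
    by split; [apply: (Z_e e)|apply: (ZeP e).1].
  by apply: (ZlP e).2 => //; apply: Z_l.
apply: finitely_related_indep relZ => [x|i].
  by apply/range_generated/S_f/ZS/valP.
apply/range_generated.
have genZ z : z \in Z -> generated (fun y => exists x : seq_sub Z, y = val x) z.
  by move=> zZ; apply: generated_in; exists (SeqSub zZ).
have genV p x : vgen Z p x -> generated (fun y => exists x : seq_sub Z, y = val x) x.
  by apply: generated_sub => [|z [/genZ]] //; apply: generated_subgroup.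
have [n] := (ZfP i).2 Z (Z_f i).
elim=> {n} [p d /genV //|e d x q n eE /genV Vd _ Vx].
by apply: generatedM Vx; apply: generatedM Vd _; apply/genZ/Z_sg.
Qed.

End SubgroupGraph.

(** Karrass and Solitar: coherence passes from [H] to the amalgam when all
    subgroups of the amalgamated subgroup are finitely generated. *)
Theorem amalgam_coherent : noetherian K -> coherent_in H ->
  coherent_in (generated (fun y => H y \/ y = v)).
Proof.
move=> noethK cohH I f f_gen.
pose S := generated (fun y => exists i, y = f i).
have sS : is_subgroup S by apply: generated_subgroup.
have [vr [er [vrP vrE erP erE er_vr]]] := nested_double_coset_reps sS sH sK KH.
have /choice [sg sgP] e : exists s, exists k, [/\ S s, K k & e * v = s * er (e * v) * k].
  exact: erP.
exact: (subgroup_finitely_related sS vrP vrE erP erE er_vr sgP f_gen (fun x => iff_refl _)).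
Qed.

End Amalgam.

(** * Reduced words of cosets *)

(** The normal form in an amalgam of [H] and K x <v> over [K] : the element
    h_0 v h_1 v ... v h_n corresponds to the word of cosets h_0 K, h_0 h_1 K, ...,
    the last of which is h_0 ... h_(n-1) K, and consecutive cosets are distinct
    when the inner h_i are outside [K].  The group [H] acts by translating all
    letters, and [v] by adding or removing the letter [K] in front. *)
Section ReducedWords.
Variables (G : groupType) (K : G -> Prop) (sK : is_subgroup K) (rep : G -> G).
Hypotheses (repP : forall g, K (g^-1 * rep g))
  (repE : forall g h, K (g^-1 * h) -> rep g = rep h).

Lemma rep_inj g h : rep g = rep h -> K (g^-1 * h).
Proof.
have [_ KM KV] := sK => gh; have := KM _ _ (repP g) (KV _ (repP h)).
by rewrite gh !gnorm.
Qed.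

Lemma rep_id g : rep (rep g) = rep g.
Proof. by apply/esym/repE. Qed.

Lemma rep_mulr g h : rep (g * rep h) = rep (g * h).
Proof. by apply/esym/repE; rewrite invgM -mulgA mulKg. Qed.

Definition reduced (y : seq G) :=
  all (fun z => rep z == z) y && sorted (fun a b => a != b) y.

Definition shift g (y : seq G) := [seq rep (g * z) | z <- y].

Definition toggle (y : seq G) :=
  if y is z :: y' then if z == rep 1 then y' else rep 1 :: y else [:: rep 1].

Lemma shift_reduced g y : reduced y -> reduced (shift g y).
Proof.
move=> /andP [y_rep y_sorted]; apply/andP; split.
  by rewrite all_map; apply/allP => z _ /=; rewrite rep_id.
case: y y_rep y_sorted => //= a y /andP [aa].
elim: y a aa => //= b y IH a /eqP aa /andP [/eqP bb y_rep] /andP [ab by_].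
rewrite IH ?bb // andbT; apply: contraNneq ab => /rep_inj.
by rewrite invgM -mulgA mulKg => /repE; rewrite aa bb => ->.
Qed.

Lemma toggle_reduced y : reduced y -> reduced (toggle y).
Proof.
case: y => [|a y] /=; first by rewrite /reduced /= rep_id eqxx.
case: eqVneq => [_|a1] /andP [/= /andP [aa y_rep] y_sorted]; apply/andP; split=> //=.
- by case: y y_sorted {y_rep} => //= b y /andP [].
- by rewrite rep_id eqxx aa.
- by rewrite eq_sym a1.
Qed.

Lemma shift1 y : reduced y -> shift 1 y = y.
Proof.
move=> /andP [/allP y_rep _]; rewrite -[RHS]map_id.
by apply/eq_in_map => z /y_rep /eqP; rewrite mul1g.
Qed.

Lemma shiftM g h y : shift (g * h) y = shift g (shift h y).
Proof. by rewrite /shift -map_comp; apply: eq_map => z /=; rewrite rep_mulr mulgA. Qed.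

Lemma toggleK y : reduced y -> toggle (toggle y) = y.
Proof.
case: y => [|a [|b y]] /andP [_ /=] y_sorted; rewrite ?eqxx //.
  by case: eqVneq => [->|] //=; rewrite eqxx.
case: eqVneq => [aE|] /=; last by rewrite eqxx.
by move: y_sorted; rewrite aE eq_sym => /andP [/negPf -> _].
Qed.

(** This is the relation of the amalgam: [K] fixes the letter [K]. *)
Lemma toggle_shift k y : K k -> reduced y -> toggle (shift k y) = shift k (toggle y).
Proof.
move=> Kk.
have rep_k : rep (k * rep 1) = rep 1.
  rewrite rep_mulr mulg1; apply: repE; rewrite mulg1.
  by case: sK => _ _; apply.
case: y => [|a y] /=; first by rewrite rep_k.
move=> /andP [/= /andP [/eqP aa _] _].
case: (eqVneq a (rep 1)) => [->|a1] /=; first by rewrite rep_k eqxx.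
case: eqVneq => [|_]; last by rewrite rep_k.
move=> /(congr1 (fun z => rep (k^-1 * z))); rewrite !rep_mulr mulKg aa mulg1.
have -> : rep k^-1 = rep 1 by apply: repE; rewrite invgK mulg1.
by move=> a1'; rewrite a1' eqxx in a1.
Qed.

End ReducedWords.

Lemma left_coset_rep (G : groupType) (K : G -> Prop) : is_subgroup K ->
  exists rep : G -> G, (forall g, K (g^-1 * rep g)) /\
    (forall g h, K (g^-1 * h) -> rep g = rep h).
Proof.
move=> [K1 KM KV].
have [|x y|x y z|r rP rE] := @equivalence_rep G (fun x y => K (x^-1 * y)).
- by move=> x; rewrite mulVg.
- by move=> /KV; rewrite invgM invgK.
- by move=> xy yz; have := KM _ _ xy yz; rewrite !gnorm.
by exists r.
Qed.

(** * Special subgroups *)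

Section Special.
Variable Gam : racg_graph.
Let V := vertex Gam.
Notation G := (coxeter_group Gam).
Notation adj u w := ([set u; w] \in edges Gam).
Implicit Types (W L : {set V}) (u v w : V).

Definition special W : G -> Prop := generated (fun y => exists2 u, u \in W & y = cgen u).

Lemma special_subgroup W : is_subgroup (special W).
Proof. exact: generated_subgroup. Qed.

Lemma special_cgen W u : u \in W -> special W (cgen u).
Proof. by move=> uW; apply: generated_in; exists u. Qed.

Lemma specialT x : special [set: V] x.
Proof.
have [w ->] := cgen_weval x.
have : generated (fun y => exists u, y = cgen u) (weval (@cgen Gam) w).
  by apply/range_generated; exists w.
by apply: generated_mono => _ [u ->]; exists u; rewrite ?inE.
Qed.

Lemma special0 x : special set0 x -> x = 1.
Proof.
move: x; apply: generated_sub => [|x [u]]; last by rewrite inE.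
by split=> // [_ _ -> ->|_ ->]; rewrite ?mulg1 ?invg1.
Qed.

Lemma adjC u w : adj u w = adj w u.
Proof. by rewrite setUC. Qed.

Lemma adj_neq u w : adj u w -> u != w.
Proof. by move/edges_card2; rewrite cards2; case: eqP. Qed.

Definition link W v := [set u in W | adj v u].

Lemma special_link_commute W v k : special (link W v) k -> commute (cgen v) k.
Proof.
move: k; apply: generated_sub => [|_ [u + ->]]; last first.
  by rewrite inE => /andP [_ /cgen_commute].
split; [exact: commute1|by move=> x y; apply: commuteM|by move=> x; apply: commuteV].
Qed.

Section RemoveVertex.
Variables (W : {set V}) (v : V).
Notation K := (special (link W v)).
Notation H := (special (W :\ v)).

Lemma link_sub x : K x -> H x.
Proof.
apply: generated_mono => _ [u + ->]; rewrite inE => /andP [uW vu].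
by exists u => //; rewrite !inE uW eq_sym adj_neq.
Qed.

(** The action on reduced words is defined on the generators; vertices outside [W]
    act trivially, which makes it an action of the whole Coxeter group, and the
    argument can take place inside that group. *)
Lemma special_remove : noetherian K -> coherent_in H -> coherent_in (special W).
Proof.
move=> noethK cohH.
have sK := special_subgroup (link W v); have sH := special_subgroup (W :\ v).
have [rep [repP repE]] := left_coset_rep sK.
pose Y := {y : seq G | reduced rep y}.
pose move u (y : seq G) :=
  if u == v then toggle rep y else if u \in W then shift rep (cgen u) y else y.
have move_red u y : reduced rep y -> reduced rep (move u y).
  move=> yr; rewrite /move; case: eqP => _; first exact: (toggle_reduced repP repE).
  by case: ifP => _ //; apply: (shift_reduced sK repP repE).
pose m u (y : Y) : Y := Sub (move u (val y)) (move_red u _ (valP y)).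
have mK u : involutive (m u).
  move=> y; apply: val_inj; rewrite /= /move; have yr := valP y.
  case: eqP => _; first exact: toggleK.
  case: (u \in W) => //; rewrite -(shiftM repP repE) cgen2; exact: shift1.
have mC u w : adj u w -> forall y, m u (m w y) = m w (m u y).
  move=> uw y; apply: val_inj; rewrite /= /move; have yr := valP y.
  have togC x : adj v x -> x \in W ->
      toggle rep (shift rep (cgen x) (val y)) = shift rep (cgen x) (toggle rep (val y)).
    move=> vx xW; apply: (toggle_shift sK repP repE) => //.
    by apply: special_cgen; rewrite inE xW.
  case: (eqVneq u v) (adj_neq uw) => [uE|_]; case: (eqVneq w v) => [wE|_].
  - by rewrite uE wE eqxx.
  - by case: ifP => // wW _; apply: togC => //; rewrite -uE.
  - by case: ifP => // uW _; apply/esym/togC => //; rewrite adjC -wE.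
  by do 2![case: ifP => //] => *; rewrite -!(shiftM repP repE) cgen_commute.
have [act [act1 actM actE]] := coxeter_action mK mC.
have act_H h y : H h -> val (act h y) = shift rep h (val y).
  move=> Hh; move: h Hh y; apply: generated_sub => [|_ [u uW ->] y]; last first.
    by rewrite actE /= /move; move: uW; rewrite !inE => /andP [/negPf -> ->].
  split=> [y|g h IHg IHh y|g IHg y].
  - by rewrite act1 shift1 //; apply: valP.
  - by rewrite actM IHg IHh -(shiftM repP repE).
  - have := IHg (act g^-1 y); rewrite -actM mulgV act1 => ->.
    by rewrite -(shiftM repP repE) mulVg shift1 //; apply: valP.
pose eps : Y := Sub [::] isT.
pose hd (y : Y) g := ohead (val y) = Some (rep g).
have hd_act h y g : H h -> hd y g -> hd (act h y) (h * g).
  rewrite /hd => /act_H ->; case: (val y) => //= z y' [->].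
  by rewrite (rep_mulr repP repE).
have hd_v y : ~ hd y 1 -> hd (act (cgen v) y) 1.
  rewrite /hd actE /= /move eqxx; case: (val y) => //= z y' nz.
  by case: eqP nz => [->|].
have hd_inj y g g' : hd y g -> hd y g' -> K (g^-1 * g').
  by rewrite /hd => -> [/(rep_inj sK repP)].
have act_eps h : H h -> act h eps = eps.
  by move=> Hh; apply: val_inj; rewrite act_H.
have hd_eps g : ~ hd eps g by [].
have coh := amalgam_coherent sH sK link_sub (cgen2 v)
  (@special_link_commute W v) act1 actM act_eps hd_eps hd_act hd_v hd_inj noethK cohH.
move=> X f fW; apply: coh => x; apply: generated_mono (fW x) => _ [u uW ->].
have [->|uv] := eqVneq u v; [by right|left].
by apply: special_cgen; rewrite !inE uv.
Qed.

End RemoveVertex.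

(** * Coxeter groups of small graphs *)

Lemma commute_conj (g h : G) : commute g h -> g * h * g^-1 = h /\ g^-1 * h * g = h.
Proof. by move=> gh; split; [rewrite gh mulgK | rewrite -mulgA -gh mulKg]. Qed.

(** The non-edges inside [L] are pairwise disjoint. *)
Definition matching_complement L := forall u w w', u \in L -> w \in L -> w' \in L ->
  w != u -> w' != u -> ~~ adj u w -> ~~ adj u w' -> w = w'.

(** If u and w are not adjacent, then both commute with the special subgroup N of
    the other vertices, and N, <N, uw>, <N, u, w> is a chain of cyclic extensions,
    as u conjugates uw to its inverse. *)
Lemma special_noetherian L : matching_complement L -> noetherian (special L).
Proof.
move: {2}#|L| (leqnn #|L|) => n; elim: n L => [|n IH] L cardL ML.
  apply: noetherian_sub (@noetherian1 _) => x.
  by move: cardL; rewrite leqn0 cards_eq0 => /eqP ->; apply: special0.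
have [->|[u uL]] := set_0Vmem L.
  by apply: noetherian_sub (@noetherian1 _) => x; apply: special0.
have MS (L' : {set V}) : L' \subset L -> matching_complement L'.
  by move=> /subsetP L'L a b c aL bL cL; apply: ML; apply: L'L.
have gen_norm (A : G -> Prop) g : (forall a, A a -> commute g a) ->
    forall a, A a -> generated A (g * a * g^-1) /\ generated A (g^-1 * a * g).
  by move=> gA a Aa; have [-> ->] := commute_conj (gA a Aa); split; apply: generated_in.
have [/existsP [w /and3P [wL wu nuw]]|] :=
    boolP [exists w, [&& w \in L, w != u & ~~ adj u w]]; last first.
  rewrite negb_exists => /forallP adj_u.
  have N : noetherian (special (L :\ u)).
    apply: IH; last by apply: MS; apply: subsetDl.
    by rewrite -ltnS; apply: leq_trans cardL; rewrite (cardsD1 u L) uL.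
  have {}N := noetherian_cyclic_ext N (gen_norm _ (cgen u) _).
  apply: noetherian_sub (N _) => [x|_ [w + ->]].
    apply: generated_mono => _ [w wL ->].
    have [->|wu] := eqVneq w u; [by right|left; exists w => //].
    by rewrite !inE wu wL.
  rewrite !inE => /andP [wu wL]; apply: cgen_commute.
  by move: (adj_u w); rewrite wL wu negbK.
pose L' := L :\ u :\ w.
have N : noetherian (special L').
  apply: IH; last by apply: MS; apply: subset_trans (subsetDl _ _) (subsetDl _ _).
  by rewrite -ltnS; apply: leq_trans cardL; rewrite (cardsD1 u L) uL ltnS subset_leq_card ?subsetDl.
have comm_u x : x \in L' -> commute (cgen u) (cgen x).
  rewrite !inE => /and3P [xw xu xL]; apply: cgen_commute.
  by apply: contraNT xw => nux; apply/eqP/(ML u).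
have comm_w x : x \in L' -> commute (cgen w) (cgen x).
  rewrite !inE => /and3P [xw xu xL]; apply: cgen_commute.
  by apply: contraNT xu => nwx; apply/eqP/(ML w); rewrite // 1?adjC // eq_sym.
pose t := cgen u * cgen w.
have {}N : noetherian (generated (fun y => (exists2 x, x \in L' & y = cgen x) \/ y = t)).
  apply: (noetherian_cyclic_ext N); apply: gen_norm => _ [x xL' ->].
  by apply/commute_sym/commuteM; apply/commute_sym; [apply: comm_u|apply: comm_w].
apply: noetherian_sub (noetherian_cyclic_ext (x := cgen u) N _) => [x|a].
  apply: generated_sub; first exact: generated_subgroup.
  move=> _ [x' xL ->]; have [->|xu] := eqVneq x' u; first by apply: generated_in; right.
  have [->|xw] := eqVneq x' w.
    rewrite -[cgen w](mulKg (cgen u)); apply: generatedM.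
      by apply/generatedV/generated_in; right.
    by apply: generated_in; left; right.
  by apply: generated_in; left; left; exists x'; rewrite // !inE xw xu.
case=> [[x xL' ->]|->].
  have [-> ->] := commute_conj (comm_u x xL').
  by split; apply: generated_in; left; exists x.
have tV : t^-1 = cgen w * cgen u by rewrite /t invgM !cgenV.
rewrite !cgenV /t !mulgA cgen2 mul1g -tV.
by split; apply/generatedV/generated_in; right.
Qed.

Lemma coherent_special0 : coherent_in (special set0).
Proof.
move=> X f f0; have f1 x : f x = 1 by apply/special0/f0.
exists [seq [:: (x, true)] | x <- enum X] => [_ /mapP [x _ ->]|w _].
  by rewrite /= mulg1; apply: f1.
apply/pres_class1; elim: w => // -[x b] w IH.
have gx1 : pres_gen (fun r => r \in [seq [:: (x, true)] | x <- enum X]) x = 1.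
  rewrite -[LHS]mulg1; apply/(pres_class1 _ [:: (x, true)])/pres_relator.
  by rewrite (map_f (fun x => [:: (x, true)])) // mem_enum.
by rewrite /= IH /leval /= gx1 invg1 mulg1; case: b.
Qed.

Lemma small_matching L : #|L| <= 2 -> matching_complement L.
Proof.
move=> cardL u w w' uL wL w'L wu w'u _ _; apply/eqP; apply: contraTT cardL => ww'.
rewrite -ltnNge; apply: leq_trans (_ : #|[set u; w; w']| <= _).
  by rewrite setUC cardsU1 cards2 !inE (negPf w'u) (eq_sym u w) wu eq_sym (negPf ww').
by apply/subset_leq_card/subsetP => x; rewrite !inE => /orP [/orP [] |] /eqP ->.
Qed.

(** A vertex with two non-neighbours besides itself has at most two neighbours. *)
Lemma dense_matching W v : #|W| <= 5 -> (forall u, u \in W -> 2 < #|link W u|) ->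
  matching_complement (link W v).
Proof.
move=> cardW dense u w w'; rewrite !inE.
move=> /andP [uW _] /andP [wW _] /andP [w'W _] wu w'u nuw nuw'.
apply/eqP; apply: contraTT (dense u uW) => ww'; rewrite -leqNgt.
have : link W u \subset W :\ u :\ w :\ w'.
  apply/subsetP => x; rewrite !inE => /andP [-> ux]; rewrite andbT.
  apply/and3P; split; last by rewrite eq_sym adj_neq.
  - by apply: contraNneq nuw' => <-.
  - by apply: contraNneq nuw => <-.
move/subset_leq_card; move/leq_trans; apply.
move: cardW; rewrite (cardsD1 u W) uW (cardsD1 w (W :\ u)) !inE wu wW.
by rewrite (cardsD1 w' (W :\ u :\ w)) !inE eq_sym ww' w'u w'W.
Qed.

(** Remove a vertex of degree at most two if there is one, and any vertex
    otherwise. *)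
Lemma coherent_special W : #|W| <= 5 -> coherent_in (special W).
Proof.
move: {2}#|W| (leqnn #|W|) => n; elim: n W => [|n IH] W cardW W5.
  move: cardW; rewrite leqn0 cards_eq0 => /eqP ->; exact: coherent_special0.
have [->|[v0 v0W]] := set_0Vmem W; first exact: coherent_special0.
have [v vW Mv] : exists2 v, v \in W & matching_complement (link W v).
  have [/existsP [v /andP [vW v2]]|] := boolP [exists v, (v \in W) && (#|link W v| <= 2)].
    by exists v => //; apply: small_matching.
  rewrite negb_exists => /forallP dense; exists v0 => //.
  apply: dense_matching => // u uW.
  by move: (dense u); rewrite uW /= -ltnNge.
have cardW1 : #|W| = #|W :\ v|.+1 by rewrite (cardsD1 v W) vW.
apply: (special_remove (v := v)); first exact: special_noetherian.
by apply: IH; [rewrite -ltnS -cardW1|apply: ltnW; rewrite -cardW1].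
Qed.

(** Handshake lemma: otherwise the degrees would add up to at least 18. *)
Lemma low_degree_vertex : #|V| = 6 -> #|edges Gam| <= 8 ->
  exists v, #|link [set: V] v| <= 2.
Proof.
move=> V6 E8; apply/existsP; apply: contraTT E8; rewrite negb_exists -ltnNge => /forallP deg3.
have deg_le v : #|link [set: V] v| <= \sum_(e in edges Gam) (v \in e).
  rewrite -big_mkcondr /= sum1_card.
  rewrite -(card_in_imset (f := fun u => [set v; u])).
    apply/subset_leq_card/subsetP => _ /imsetP [u + ->].
    by rewrite inE => /andP [_ vu]; rewrite unfold_in /= vu set21.
  move=> u w; rewrite !inE /= => vu vw /setP /(_ u).
  by rewrite !inE eqxx orbT eq_sym (negPf (adj_neq vu)) /= => /esym /eqP.
have : \sum_(v : V) 3 <= \sum_(v : V) \sum_(e in edges Gam) (v \in e).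
  by apply: leq_sum => v _; apply: leq_trans (deg_le v); rewrite ltnNge.
rewrite sum_nat_const V6 exchange_big /=.
rewrite (eq_bigr (fun=> 2)) ?sum_nat_const; last first.
  by move=> e /edges_card2 <-; rewrite -big_mkcond /= sum1_card.
by rewrite -[(6 * 3)%N]/(9 * 2)%N leq_pmul2r.
Qed.

Lemma coherent_small : #|V| <= 5 \/ (#|V| = 6 /\ #|edges Gam| <= 8) ->
  coherent G.
Proof.
move=> small; have cohT : coherent_in (special [set: V]).
  case: small => [V5|[V6 E8]]; first by apply: coherent_special; rewrite cardsT.
  have [v v2] := low_degree_vertex V6 E8.
  apply: (special_remove (v := v)).
    by apply: special_noetherian; apply: small_matching.
  apply: coherent_special; have := cardsD1 v [set: V].
  by rewrite cardsT V6 in_setT add1n => -[<-].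
move=> S /finitely_generated_family [X [f Sf]].
by apply: finitely_related_presented Sf _; apply: cohT => x; apply: specialT.
Qed.

End Special.

Theorem proposition6p1 (Gam : racg_graph) :
  (#|vertex Gam| <= 5 \/ (#|vertex Gam| = 6 /\ #|edges Gam| <= 8) ->
     coherent (coxeter_group Gam)) /\
  (is_complete_bipartite 3 3 Gam -> ~ coherent (coxeter_group Gam)).
Proof.
split; first exact: coherent_small.
by move=> [A [B [_ AB0 cardA cardB edgesE]]]; apply: K33_incoherent edgesE.
Qed.
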